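(* There are no 6-vertex-critical ($P_6$, diamond)-free graphs with clique number $5$.
   Context: All graphs are finite and simple. $P_n$ and $K_n$ denote the path and the complete graph on $n$ vertices. The diamond is the graph obtained from $K_4$ by removing an edge. A graph $G$ contains a graph $H$ if some induced subgraph of $G$ is isomorphic to $H$; $G$ is $(H_1,\ldots,H_n)$-free if it contains none of $H_1,\ldots,H_n$. The clique number of $G$ is the size of a largest clique in $G$, and $\chi(G)$ is the chromatic number. A graph $G$ is $k$-vertex-critical if $\chi(G)=k$ and every proper induced subgraph of $G$ has chromatic number smaller than $k$. *)

(* Defs.v *)
From mathcomp Require Import all_boot.

Set Implicit Arguments.
Unset Strict Implicit.
Unset Printing Implicit Defensive.

Record sgraph := SGraph {
  vertex :> finType;
  adj : rel vertex;
  adj_sym : symmetric adj;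
  adj_irr : irreflexive adj
}.

Section Induced.
Variables (G : sgraph) (S : {set G}).

Definition induced_adj : rel {x : G | x \in S} :=
  fun x y => adj (val x) (val y).

Fact induced_sym : symmetric induced_adj.
Proof. by move=> x y; apply: adj_sym. Qed.

Fact induced_irr : irreflexive induced_adj.
Proof. by move=> x; apply: adj_irr. Qed.

Definition induced : sgraph := SGraph induced_sym induced_irr.

End Induced.

Definition isomorphic (G H : sgraph) : Prop :=
  exists f : G -> H, bijective f /\ forall x y, adj (f x) (f y) = adj x y.

Definition contains (G H : sgraph) : Prop :=
  exists S : {set G}, isomorphic (induced S) H.

Definition free (Hs : seq sgraph) (G : sgraph) : Prop :=
  foldr (fun H P => ~ contains G H /\ P) True Hs.

Section Path.
Variable n : nat.

Definition path_adj : rel 'I_n := fun i j => (i.+1 == j) || (j.+1 == i).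

Fact path_sym : symmetric path_adj.
Proof. by move=> i j; rewrite /path_adj orbC. Qed.

Fact path_irr : irreflexive path_adj.
Proof. by move=> i; rewrite /path_adj orbb gtn_eqF. Qed.

Definition path_graph : sgraph := SGraph path_sym path_irr.

End Path.

Section Complete.
Variable n : nat.

Definition complete_adj : rel 'I_n := fun i j => i != j.

Fact complete_sym : symmetric complete_adj.
Proof. by move=> i j; rewrite /complete_adj eq_sym. Qed.

Fact complete_irr : irreflexive complete_adj.
Proof. by move=> i; rewrite /complete_adj eqxx. Qed.

Definition complete_graph : sgraph := SGraph complete_sym complete_irr.

End Complete.

Section DelEdge.
Variables (G : sgraph) (u v : G).

Definition del_edge_adj : rel G :=
  fun x y => adj x y && ([set x; y] != [set u; v]).

Fact del_edge_sym : symmetric del_edge_adj.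
Proof. by move=> x y; rewrite /del_edge_adj adj_sym setUC. Qed.

Fact del_edge_irr : irreflexive del_edge_adj.
Proof. by move=> x; rewrite /del_edge_adj adj_irr. Qed.

Definition del_edge : sgraph := SGraph del_edge_sym del_edge_irr.

End DelEdge.

Definition diamond : sgraph :=
  @del_edge (complete_graph 4) (ord0 : 'I_4) (ord_max : 'I_4).

Definition is_clique (G : sgraph) (K : {set G}) : bool :=
  [forall x in K, forall y in K, (x != y) ==> adj x y].

Definition clique_number (G : sgraph) : nat :=
  \max_(K : {set G} | is_clique K) #|K|.

Definition proper_coloring (G : sgraph) k (c : {ffun G -> 'I_k}) : bool :=
  [forall x, forall y, adj x y ==> (c x != c y)].

Definition colorable (G : sgraph) (k : nat) : bool :=
  [exists c : {ffun G -> 'I_k}, proper_coloring c].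

Fact colorable_ex (G : sgraph) : exists k, colorable G k.
Proof.
exists #|G|; apply/existsP; exists [ffun x => enum_rank x].
apply/forallP => x; apply/forallP => y; apply/implyP => xy.
rewrite !ffunE (inj_eq enum_rank_inj).
by apply: contraTneq xy => ->; rewrite adj_irr.
Qed.

Definition chromatic_number (G : sgraph) : nat := ex_minn (colorable_ex G).

Definition vertex_critical (k : nat) (G : sgraph) : Prop :=
  chromatic_number G = k /\
  forall S : {set G}, S \proper [set: G] -> chromatic_number (induced S) < k.

(* Main.v *)
(* Let G be a counterexample. Removing a nonempty set of vertices makes G
   5-colourable, so whenever every colouring of the rest would extend back, some
   vertex is missing from what has been seen of G. Hence an induced subgraph H of
   G forces a further vertex w, with a prescribed adjacency to H, as soon as
     - some A in H has a map phi from A to H - A such that phi, extended by the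
       identity, preserves adjacency: some w is adjacent to some a in A but not
       to phi a;
     - some v has degree at most 4 in H: some w is adjacent to v;
     - H is 5-colourable: some w is adjacent to a vertex of H.
   Branching on the neighbours of w in H gives an induced P6, diamond or K6, or a
   larger induced subgraph of G. Started from K5, this search terminates. *)

Require Import Defs.
From Stdlib Require Strings.Byte.
From mathcomp Require Import all_boot.

Set Implicit Arguments.
Unset Strict Implicit.
Unset Printing Implicit Defensive.

(** Growing K5 by arbitrary new vertices would never end: K5 with any number of pendant vertices at
    one of its vertices is (P6, diamond)-free of clique number 5. Hence every extension has to be
    one that criticality forces. The forced vertex w lies outside H because no vertex of H can have
    the prescribed adjacency: phi already preserves adjacency inside H, and the at most 4 neighbours
    of v in H are discounted. For a one-element A the first rule is the classical remark that a
    critical graph has no two vertices with N(u) contained in N(v), read inside H; the second is the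
    bound 5 on the minimum degree; the third is connectedness, and it prescribes the least. The
    search itself is not formalised. Its record is a list of entries, written against the direction
    of the search: an entry certifies that G has no induced copy of its graph, provided that G has
    none of P6, diamond, K6 and the graphs of the earlier entries. Only the checker of such entries
    is proved sound. The last entry excludes K5, which G contains since its clique number is 5. *)

(* A graph on 0, ..., n - 1: the j-th list holds the neighbours of j below j. *)
Definition pattern := seq (seq nat).

(** The guards [i < j] and [j < i] make this symmetric and irreflexive for arbitrary lists, so a
    pattern taken from the certificate needs no test of well-formedness. *)
Definition padj (P : pattern) (i j : nat) : bool :=
  (i < j) && (i \in nth [::] P j) || (j < i) && (j \in nth [::] P i).

Lemma padjC P i j : padj P i j = padj P j i.
Proof. by rewrite /padj orbC. Qed.

Lemma padjn P i : padj P i i = false.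
Proof. by rewrite /padj ltnn. Qed.

(** The map [f] is total on [nat] so that patterns of all sizes share one type of embedding; only
    its values below [size P] matter. *)
Definition occurs_at (G : sgraph) (P : pattern) (f : nat -> G) : Prop :=
  {in gtn (size P) &, injective f} /\
  {in gtn (size P) &, forall i j, adj (f i) (f j) = padj P i j}.

Definition avoids (G : sgraph) (Fs : seq pattern) : Prop :=
  {in Fs, forall P (f : nat -> G), ~ occurs_at P f}.

Lemma occurs_at_lower (G : sgraph) (P : pattern) (f : nat -> G) :
    {in gtn (size P) &, injective f} ->
    (forall i j, j < i < size P -> adj (f i) (f j) = padj P i j) ->
  occurs_at P f.
Proof.
move=> f_inj fP; split=> // i j; rewrite !inE => lti ltj.
have [ltij|ltji|->] := ltngtP i j; last by rewrite padjn adj_irr.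
  by rewrite padjC adj_sym fP ?ltij.
by rewrite fP ?ltji.
Qed.

(** * Partial colourings *)

(** Colours are assigned on all of [G] and are arbitrary outside [S]. This avoids functions on the
    subtype, and colourings can be composed with maps of [G] or glued by a plain conditional. *)
Definition colored_on (G : sgraph) k (S : {set G}) : Prop :=
  exists c : G -> 'I_k, {in S &, forall x y, adj x y -> c x != c y}.

Lemma colored_on_widen (G : sgraph) k l (S : {set G}) :
  k <= l -> colored_on k S -> colored_on l S.
Proof.
move=> le_kl [c cP]; exists (widen_ord le_kl \o c) => x y xS yS xy /=.
by rewrite -(inj_eq val_inj) /= (inj_eq val_inj) cP.
Qed.

Lemma colored_on_colorable (G : sgraph) k :
  colored_on k [set: G] -> colorable G k.
Proof.
case=> c cP; apply/existsP; exists [ffun x => c x].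
by apply/forallP=> x; apply/forallP=> y; apply/implyP=> xy; rewrite !ffunE cP.
Qed.

Lemma colored_on_induced (G : sgraph) k (S : {set G}) :
  colorable (induced S) k.+1 -> colored_on k.+1 S.
Proof.
(* Outside [S] the colour is the default [ord0], available because the number of colours is a
   successor. *)
case/existsP=> c /forallP cP; exists (fun x => oapp c ord0 (insub x)).
move=> x y xS yS xy; rewrite !insubT /=.
by have /forallP/(_ (Sub y yS))/implyP := cP (Sub x xS); apply.
Qed.

(** * What criticality forces around a partial copy of a pattern *)

Section Critical.

Variables (G : sgraph) (k : nat).
(** With [k.+2] the palette has [k.+1] colours and is never empty, so default colours exist; [k] is
    the largest degree at which a vertex of the rest can still be given a free colour. *)
Hypothesis crit : vertex_critical k.+2 G.

Lemma critical_not_colored : ~ colored_on k.+1 [set: G].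
Proof.
move=> /colored_on_colorable col; have := crit.1; rewrite /chromatic_number.
by case: ex_minnP => m _ /(_ _ col) + m_eq; rewrite m_eq ltnn.
Qed.

Lemma critical_colored S : S != [set: G] -> colored_on k.+1 S.
Proof.
rewrite -properT => /crit.2; rewrite /chromatic_number.
case: ex_minnP => -[|m] col _ lt_m.
  (* With chromatic number 0 a colouring maps into the empty ['I_0], so [S] is empty and a constant
     map colours it. *)
  have [c _] := existsP col.
  suff -> : S = set0 by exists (fun=> ord0) => x y; rewrite inE.
  by apply/setP=> x; rewrite inE; apply/negP => xS; case: (c (Sub x xS)).
by apply: (colored_on_widen (_ : m.+1 <= _)) => //; apply: colored_on_induced.
Qed.

(** By criticality, G without the image of [A] has a colouring. If no such w existed, moving each
    [f i], [i] in [A], to [f (phi i)] would be a homomorphism of G into that smaller graph: inside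
    the pattern by [phiP], and towards an outside vertex because each outside neighbour of [f i]
    would also be one of [f (phi i)]. Composition would colour G with [k.+1] colours. *)
Lemma critical_hom (P : pattern) (f : nat -> G) (A : seq nat) (phi : nat -> nat) :
    occurs_at P f -> A != [::] -> all (gtn (size P)) A ->
    (forall i, i < size P -> phi i < size P) ->
    {in A, forall i, phi i \notin A} -> (forall i, i \notin A -> phi i = i) ->
    {in A, forall i j, j < size P -> padj P i j -> padj P (phi i) (phi j)} ->
  exists w, (forall i, i < size P -> f i != w) /\
    exists2 i, i \in A & adj (f i) w && ~~ adj (f (phi i)) w.
Proof.
move=> [f_inj fP] A0 /allP ltA lt_phi phiA phi_id phiP.
case: (boolP [exists w, [forall i : 'I_(size P), f i != w] &&
    has (fun i => adj (f i) w && ~~ adj (f (phi i)) w) A]).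
  case/existsP=> w /andP[/forallP fw /hasP wA]; exists w; split=> // i lti.
  exact: (fw (Ordinal lti)).
move/existsPn=> no_w; case: critical_not_colored.
pose S := [set x | x \notin map f A].
have [|c cP] := critical_colored (S := S).
  apply/eqP=> S_T; case: A A0 @S S_T {ltA phiA phi_id phiP no_w} => //.
  by move=> a A _ S /setP/(_ (f a)); rewrite !inE eqxx.
have fS i : i < size P -> (f i \in S) = (i \notin A).
  move=> lti; rewrite inE; congr (~~ _); apply/mapP/idP=> [[j jA /f_inj->]|iA] //.
    exact: ltA.
  by exists i.
(* [r] sends [f i] to [f (phi i)] for [i] in [A] and fixes all other vertices. *)
pose r x := if [pick i : 'I_(size P) | f i == x] is Some i then f (phi i) else x.
have rf i : i < size P -> r (f i) = f (phi i).
  move=> lti; rewrite /r; case: pickP => [j /eqP/f_inj->//|]; first exact: (ltn_ord j).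
  by move/(_ (Ordinal lti)); rewrite eqxx.
have r_id x : (forall i, i < size P -> f i != x) -> r x = x.
  move=> fx; rewrite /r; case: pickP => // j; first by rewrite (negPf (fx _ _)).
have rS x : r x \in S.
  case: (boolP [exists i : 'I_(size P), f i == x]) => [/existsP[i /eqP<-]|/existsPn fx].
    rewrite rf // fS ?lt_phi //; case: (boolP (val i \in A)) => [/phiA//|iA].
    by rewrite phi_id.
  have fx' i : i < size P -> f i != x by move=> lti; apply: (fx (Ordinal lti)).
  by rewrite r_id // inE; apply/mapP=> -[i /ltA/fx' + xi]; rewrite xi eqxx.
(* Edges with an end [x] outside [S], that is, with a moved end. The other end is either in the
   pattern, where [phiP] applies whether it moves or not, or outside it and fixed by [r]. *)
have radj x y : adj x y -> x \notin S -> adj (r x) (r y).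
  rewrite inE negbK => + /mapP[i iA xi]; rewrite {x}xi => iy.
  have lti := ltA _ iA; rewrite rf //.
  case: (boolP [exists j : 'I_(size P), f j == y])
    => [/existsP[j /eqP yj]|/existsPn fy].
    by move: iy; rewrite -yj rf // !fP ?inE ?lt_phi // => /phiP->.
  have fy' j : j < size P -> f j != y by move=> ltj; apply: (fy (Ordinal ltj)).
  (* As [y] is not in the pattern, only the second half of the condition on w can fail for it: no
     [f a] with [a] in [A] is adjacent to [y] unless [f (phi a)] is. *)
  rewrite (r_id y) //; move/nandP: (no_w y) => [/forallPn[j]|/hasPn/(_ _ iA)].
    by rewrite fy'.
  by rewrite iy /= negbK.
have r_S x : x \in S -> r x = x.
  case: (boolP [exists i : 'I_(size P), f i == x]) => [/existsP[i /eqP<-]|/existsPn fx].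
    by rewrite fS // rf // => /phi_id->.
  by rewrite r_id // => i lti; apply: (fx (Ordinal lti)).
(* An edge inside [S] is fixed by [r]; any other edge is preserved by [radj], applied from its moved
   end. *)
exists (c \o r) => x y _ _ xy /=; apply: cP => //.
have [xS|/(radj _ _ xy)//] := boolP (x \in S).
have [yS|yS] := boolP (y \in S); first by rewrite !r_S.
by rewrite adj_sym radj // adj_sym.
Qed.

(** If all neighbours of [v] were in [s], a colouring of G without [v] would use at most [k] of the
    [k.+1] colours on [s], and a spare one would be left for [v]. In the application [s] lists the
    neighbours of [v] inside the pattern. *)
Lemma critical_degree (v : G) (s : seq G) :
  size s <= k -> exists w, adj v w && (w \notin s).
Proof.
move=> size_s; apply/existsP; apply: contraT => /existsPn Nv.
case: critical_not_colored; have [|c cP] := critical_colored (S := ~: [set v]).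
  by apply/eqP=> /setP/(_ v); rewrite !inE eqxx.
have [a aP] : exists a, a \notin map c s.
  apply/existsP; apply: contraT => /existsPn all_s.
  have: #|'I_k.+1| <= size (map c s).
    apply: leq_trans (card_size _); apply: subset_leq_card; apply/subsetP=> a _.
    by have := all_s a; rewrite negbK.
  by rewrite card_ord size_map leqNgt ltnS size_s.
have aN y : adj v y -> a != c y.
  move=> vy; have := Nv y; rewrite vy negbK /= => ys.
  by apply: contraNneq aP => ->; apply: map_f.
exists (fun x => if x == v then a else c x) => x y _ _ /=.
case: (eqVneq x v) => [->|xv]; case: (eqVneq y v) => [->|yv]; first by rewrite adj_irr.
- exact: aN.
- by rewrite adj_sym eq_sym; apply: aN.
by apply: cP; rewrite !inE.
Qed.

(** Were no edge to leave [S], a colouring of [S] and one of its complement, the latter given by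
    criticality since [S] is nonempty, would combine into a colouring of G. *)
Lemma critical_adjacent (S : {set G}) : S != set0 -> colored_on k.+1 S ->
  exists2 v, v \in S & exists2 w, w \notin S & adj v w.
Proof.
move=> S0 [c cP].
have: [exists v in S, exists w, (w \notin S) && adj v w].
  apply: contraT => /exists_inPn no_w; case: critical_not_colored.
  have [|d dP] := critical_colored (S := ~: S).
    by apply: contraNneq S0 => /(congr1 (@setC _)); rewrite setCK setCT => ->.
  (* No edge leaves [S], so its two ends always lie on the same side and are coloured by the same
     one of [c] and [d]. *)
  have sep x y : adj x y -> (x \in S) = (y \in S).
    suff half x' y' : adj x' y' -> x' \in S -> y' \in S.
      by move=> xy; apply/idP/idP; apply: half; rewrite // adj_sym.
    move=> xy /no_w /existsPn/(_ y'); rewrite xy andbT negbK; exact.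
  exists (fun x => if x \in S then c x else d x) => x y _ _ xy.
  have xyS := sep x y xy; rewrite -xyS; case: ifPn => xS.
    by apply: cP => //; rewrite -xyS.
  by apply: dP => //; rewrite inE -?xyS.
case/exists_inP=> v vS /existsP[w /andP[wS vw]].
by exists v => //; exists w.
Qed.

End Critical.

(** * The certificate format and its checker *)

(** The evidence for the three forcing rules: the pairs [(i, phi i)] for [i] in [A], the vertex of
    small degree, and the list of the colours of the vertices 0, 1, and so on. *)
Inductive reducer := Hom of seq (nat * nat) | Deg of nat | Col of seq nat.

(* A case analysis on the row of a new vertex, which is numbered [size P]:
   [Node i] splits on its adjacency to [i], [Leaf k s] exhibits the k-th excluded
   pattern at the vertices [s], and at a [Vac] the row violates the reducer. *)
Inductive tree := Node of nat & tree & tree | Leaf of nat & seq nat | Vac.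

Record entry := Entry {
  entry_pattern : pattern;
  entry_reducer : reducer;
  entry_tree : tree
}.

(* The new vertex w is adjacent to [p.1] but not to [p.2] for some pair [p]; with
   [n] standing for w, a pair [(v, n)] only asks that w is adjacent to [v]. *)
Definition reducer_pairs n r : seq (nat * nat) :=
  match r with
  | Hom ps => ps
  | Deg v => [:: (v, n)]
  | Col _ => [seq (v, n) | v <- iota 0 n]
  end.

(** This is the map phi stored as an association list. For an absent key [index] points past the
    end, and the default [i] makes phi the identity off [A]. *)
Definition subst (ps : seq (nat * nat)) (i : nat) : nat :=
  nth i (unzip2 ps) (index i (unzip1 ps)).

Definition check_reducer k (P : pattern) r : bool :=
  let n := size P in
  match r with
  | Hom ps =>
      let A := unzip1 ps in
      [&& A != [::],
          all (fun p => [&& p.1 < n, p.2 < n & p.2 \notin A]) ps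
        & all (fun i => all (fun j =>
            padj P i j ==> padj P (subst ps i) (subst ps j)) (iota 0 n)) A]
  | Deg v => (v < n) && (count (padj P v) (iota 0 n) <= k)
  | Col cs =>
      [&& 0 < n, all (gtn k.+1) cs, size cs == n
        & all (fun i => all (fun j =>
            padj P i j ==> (nth 0 cs i != nth 0 cs j)) (iota 0 n)) (iota 0 n)]
  end.

(** Adjacency in the pattern extended by w, whose number is [size P]; [None] means that the branch
    has not decided it yet. *)
Definition known_adj (P : pattern) (row : seq (option bool)) i j : option bool :=
  if i == size P then nth None row j
  else if j == size P then nth None row i
  else Some (padj P i j).

(** The bound on the entries of [s] is inclusive, because the copy of [Q] may use w. Comparing the
    pairs below the diagonal is enough, by [occurs_at_lower]. *)
Definition check_leaf (Q P : pattern) (row : seq (option bool)) (s : seq nat) :=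
  [&& size s == size Q, uniq s, all (geq (size P)) s
    & all (fun i => all (fun j =>
        known_adj P row (nth 0 s i) (nth 0 s j) == Some (padj Q i j))
      (iota 0 i)) (iota 0 (size Q))].

Fixpoint check_tree (Fs : seq pattern) (P : pattern) (ps : seq (nat * nat))
    (row : seq (option bool)) (t : tree) : bool :=
  match t with
  | Node i t1 t0 => check_tree Fs P ps (set_nth None row i (Some true)) t1 &&
                    check_tree Fs P ps (set_nth None row i (Some false)) t0
  | Leaf k s => (k < size Fs) && check_leaf (nth [::] Fs k) P row s
  | Vac => all (fun p => (nth None row p.1 == Some false) ||
                         (nth None row p.2 == Some true)) ps
  end.

Definition check_entry k (Fs : seq pattern) (e : entry) : bool :=
  let: Entry P r t := e in
  check_reducer k P r && check_tree Fs P (reducer_pairs (size P) r) [::] t.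

(** A pattern, once excluded, may be cited at the leaves of all later entries. A pattern therefore
    comes after every pattern that its tree runs into, and the citations cannot be circular. *)
Fixpoint check_entries k (Fs : seq pattern) (es : seq entry) : bool :=
  if es is e :: es' then
    check_entry k Fs e && check_entries k (rcons Fs (entry_pattern e)) es'
  else true.

(** * Soundness of the checker *)

Definition extend (T : Type) n (f : nat -> T) (w : T) (i : nat) : T :=
  if i < n then f i else w.

Lemma extendn T n (f : nat -> T) w : extend n f w n = w.
Proof. by rewrite /extend ltnn. Qed.

Lemma extend_lt T n (f : nat -> T) w i : i < n -> extend n f w i = f i.
Proof. by rewrite /extend => ->. Qed.

Section Soundness.

Variables (G : sgraph) (P : pattern) (g : nat -> G).
Let n := size P.
Hypothesis gP : occurs_at P g.
Hypothesis gn : forall i, i < n -> g i != g n.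

(** Here [g n] is the new vertex w. All indices are covered, including those beyond the pattern,
    where [g] also has some value; this is why the number at a [Node] needs no bound in the
    checker. *)
Definition row_sound (row : seq (option bool)) : Prop :=
  forall i b, nth None row i = Some b -> adj (g i) (g n) = b.

Lemma row_sound_set row i :
  row_sound row -> row_sound (set_nth None row i (Some (adj (g i) (g n)))).
Proof.
move=> rowP j b; rewrite nth_set_nth /=.
by case: eqVneq => [-> [] //|_ /rowP].
Qed.

Lemma known_adjP row i j b : row_sound row -> i <= n -> j <= n ->
  known_adj P row i j = Some b -> adj (g i) (g j) = b.
Proof.
move=> rowP lei lej; rewrite /known_adj -/n.
case: (eqVneq i n) => [-> /rowP|ni]; first by rewrite adj_sym.
case: (eqVneq j n) => [-> /rowP//|nj] [<-].
by apply: gP.2; rewrite inE ltn_neqAle ?ni ?nj.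
Qed.

Lemma check_leafP (Q : pattern) row s :
  row_sound row -> check_leaf Q P row s -> occurs_at Q (g \o nth 0 s).
Proof.
move=> rowP /and4P[/eqP size_s s_uniq /allP le_s /allP sP].
have le_nth i : i < size Q -> nth 0 s i <= n.
  by move=> lti; apply/le_s/mem_nth; rewrite size_s.
apply: occurs_at_lower => [i j|i j /andP[ltji lti]] /=; last first.
  apply: (known_adjP rowP); rewrite ?le_nth //; first exact: ltn_trans lti.
  have := sP i; rewrite mem_iota lti => /(_ isT)/allP/(_ j).
  by rewrite mem_iota ltji => /(_ isT)/eqP.
(* Distinct positions of [s] hold distinct numbers. [g] separates numbers below [n] by [gP], and any
   of them from [n] by [gn]. *)
rewrite !inE => lti ltj gij; apply/eqP.
rewrite -(nth_uniq 0 _ _ s_uniq) ?size_s //; apply/eqP; move: gij.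
have := le_nth _ lti; have := le_nth _ ltj.
rewrite leq_eqVlt => /predU1P[->|ltj']; rewrite leq_eqVlt => /predU1P[->|lti'] //.
- by move/eqP; rewrite (negPf (gn lti')).
- by move/esym/eqP; rewrite (negPf (gn ltj')).
exact: gP.1.
Qed.

(** The actual adjacencies of w single out one branch of the tree. If the tree were accepted, this
    branch would end either in an excluded pattern that occurs in G, or in a [Vac] whose row
    contradicts the pair [p]. *)
Lemma check_treeP (Fs : seq pattern) ps row t :
    avoids G Fs -> row_sound row ->
    (exists2 p, p \in ps & adj (g p.1) (g n) && ~~ adj (g p.2) (g n)) ->
  ~~ check_tree Fs P ps row t.
Proof.
move=> GFs + [p p_ps /andP[p1 p2]].
elim: t row => [i t1 IH1 t0 IH0|l s|] row rowP /=.
- have := row_sound_set (i := i) rowP; rewrite negb_and.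
  by case: (adj _ _) => [/IH1->|/IH0->]; rewrite ?orbT.
- apply/andP=> -[ltl /(check_leafP rowP)]; exact/GFs/mem_nth.
apply/allPn; exists p => //; rewrite negb_or; apply/andP; split.
  by apply/eqP=> /rowP; rewrite p1.
by apply/eqP=> /rowP; apply/negP.
Qed.

End Soundness.

(** The three forcing lemmas brought to one form, so that the tree check does not depend on the
    rule: there is a vertex w off the pattern, adjacent to the first but not to the second member of
    some listed pair. *)
Lemma check_reducerP (G : sgraph) k (P : pattern) r (f : nat -> G) :
    vertex_critical k.+2 G -> occurs_at P f -> check_reducer k P r ->
  exists w, (forall i, i < size P -> f i != w) /\
    let g := extend (size P) f w in
    exists2 p, p \in reducer_pairs (size P) r
      & adj (g p.1) w && ~~ adj (g p.2) w.
Proof.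
move=> crit fP; case: r => [ps|v|cs] /=.
- case/and3P=> A0 /allP psP /allP homP; set A := unzip1 ps in A0 homP *.
  have pair i : i \in A -> (i, subst ps i) \in ps.
    move=> iA.
    have lt_i : index i A < size ps by rewrite -(size_map fst) index_mem.
    (* Both components are read at position [index i A] of the two unzipped lists, so zipping back
       yields a member of [ps]. The default of [nth] is irrelevant there, as the position is in
       range. *)
    rewrite -[X in (X, _)](nth_index 0 iA) /subst (set_nth_default 0) ?size_map //.
    by rewrite -nth_zip ?size_map // zip_unzip mem_nth.
  have ltA i : i \in A -> i < size P by move/pair/psP/and3P=> -[].
  have subst_id i : i \notin A -> subst ps i = i.
    by move=> iA; rewrite /subst nth_default // size_map -(size_map fst) memNindex.
  have lt_subst i : i < size P -> subst ps i < size P.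
    move=> lti; case: (boolP (i \in A)) => [/pair/psP/and3P[]//|/subst_id->//].
  have [|||w [fw [i iA iw]]] := critical_hom crit fP A0 _ lt_subst _ subst_id.
  - exact/allP.
  - by move=> i /pair/psP/and3P[].
  - move=> i iA j ltj; have /allP/(_ j) := homP i iA.
    by rewrite mem_iota ltj => /(_ isT)/implyP.
  - exists w; split=> //; exists (i, subst ps i); first exact: pair.
    by rewrite !extend_lt ?lt_subst ?ltA.
- case/andP=> ltv cntv.
  pose s := map f (filter (padj P v) (iota 0 (size P))).
  have [|w /andP[vw ws]] := critical_degree crit (f v) (s := s).
    by rewrite size_map size_filter.
  exists w; split=> [i lti|].
    (* A neighbour of [f v] inside the pattern belongs to [s], so the neighbour w found outside [s]
       is a new vertex. *)
    apply: contraNneq ws => iw; rewrite -iw map_f // mem_filter mem_iota lti.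
    by rewrite andbT -fP.2 ?inE // iw vw.
  exists (v, size P); first by rewrite inE.
  by rewrite /= extendn adj_irr extend_lt ?vw.
case/and4P=> P0 /allP lt_cs /eqP size_cs /allP csP.
pose S := [set x | x \in map f (iota 0 (size P))].
have fS i : i < size P -> f i \in S by move=> lti; rewrite inE map_f ?mem_iota.
have [||_ /[!inE] /mapP[i + ->] [w wS iw]] := critical_adjacent crit (S := S).
- by apply/set0Pn; exists (f 0); apply: fS.
(* Colours listed by position are carried over to vertices; by injectivity of [f] the picked
   position is the only one. The later [inord] does not alter them, since the check bounds all
   listed colours by [k]. *)
- pose c x :=
    if [pick i : 'I_(size P) | f i == x] is Some i then nth 0 cs i else 0.
  have cf l : l < size P -> c (f l) = nth 0 cs l.
    move=> ltl; rewrite /c.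
    case: pickP => [j /eqP/fP.1->//|]; first exact: ltn_ord j.
    by move/(_ (Ordinal ltl)); rewrite eqxx.
  exists (fun x => inord (c x)) => _ _ /[!inE] /mapP[i + ->] /mapP[j + ->].
  rewrite !mem_iota !add0n /= => lti ltj; rewrite fP.2 //.
  have := csP i; rewrite mem_iota lti => /(_ isT)/allP/(_ j).
  rewrite mem_iota ltj => /(_ isT)/implyP col_ij /col_ij.
  rewrite -(inj_eq val_inj) /= !inordK ?cf //.
  + by apply/lt_cs/mem_nth; rewrite size_cs.
  + by apply/lt_cs/mem_nth; rewrite size_cs.
rewrite mem_iota add0n => lti; exists w; split=> [j ltj|].
  by apply: contraNneq wS => <-; apply: fS.
exists (i, size P); first by apply/mapP; exists i; rewrite ?mem_iota.
by rewrite /= extendn adj_irr extend_lt ?iw.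
Qed.

(** An occurrence of the pattern of [e] would force a vertex w, and the accepted tree, started from
    the empty row that assumes nothing about w, refutes every possible adjacency of w. *)
Lemma check_entryP (G : sgraph) k (Fs : seq pattern) (e : entry) :
    vertex_critical k.+2 G -> avoids G Fs -> check_entry k Fs e ->
  avoids G (rcons Fs (entry_pattern e)).
Proof.
move=> crit GFs; case: e => P r t /= /andP[rP tP] Q.
rewrite mem_rcons inE => /predU1P[->|/GFs//] f fP.
have [w [fw wP]] := check_reducerP crit fP rP.
pose g := extend (size P) f w.
have gP : occurs_at P g.
  by split=> i j lti ltj; rewrite /g !extend_lt //; [apply: fP.1 | apply: fP.2].
have gn i : i < size P -> g i != g (size P).
  by move=> lti; rewrite /g extendn extend_lt ?fw.
apply/negP: tP; apply: (check_treeP gP gn _ GFs) => [i b|]; first by rewrite nth_nil.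
by rewrite /g extendn.
Qed.

Lemma check_entriesP (G : sgraph) k (Fs : seq pattern) (es : seq entry) :
    vertex_critical k.+2 G -> avoids G Fs -> check_entries k Fs es ->
  avoids G (Fs ++ map entry_pattern es).
Proof.
move=> crit; elim: es Fs => [|e es IH] Fs GFs /=; first by rewrite cats0.
case/andP=> eP /IH; rewrite cat_rcons; apply; exact: check_entryP eP.
Qed.

(** * From patterns to the graphs and the clique number of the statement *)

(** The image of [h] is the required vertex set. The isomorphism goes from the induced subgraph to
    [H], so it is the inverse of [h], obtained by choosing preimages. *)
Lemma contains_injective (G H : sgraph) (h : H -> G) :
  injective h -> {mono h : x y / adj x y} -> contains G H.
Proof.
move=> h_inj hP; exists (h @: [set: H]).
have hK (u : induced (h @: [set: H])) : {x | h x = val u}.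
  have ex_x : exists x, h x == val u.
    by have /imsetP[x _ ->] := valP u; exists x.
  by exists (xchoose ex_x); apply/eqP/(xchooseP ex_x).
exists (fun u => sval (hK u)); split.
  exists (fun x => Sub (h x) (imset_f h (in_setT x))) => [u|x].
    by apply: val_inj; rewrite /= (svalP (hK u)).
  by apply: h_inj; rewrite (svalP (hK _)).
by move=> u v; rewrite -hP !(svalP (hK _)).
Qed.

Lemma occurs_contains (G H : sgraph) (P : pattern) (f : nat -> G) (e : H -> nat) :
    occurs_at P f -> injective e -> (forall x, e x < size P) ->
    {mono e : x y / adj x y >-> padj P x y} ->
  contains G H.
Proof.
move=> fP e_inj lt_e eP.
apply: (@contains_injective _ _ (f \o e)) => [x y /= /fP.1|x y /=].
  by move=> exy; apply/e_inj/exy; apply: lt_e.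
by rewrite fP.2 ?inE ?lt_e // eP.
Qed.

Definition path6 : pattern := [:: [::]; [:: 0]; [:: 1]; [:: 2]; [:: 3]; [:: 4]].

(** The numbering is that of [diamond], whose missing edge joins the first and the last of four
    vertices, so that the embedding is just [nat_of_ord]. *)
Definition diamond_pattern : pattern := [:: [::]; [:: 0]; [:: 0; 1]; [:: 1; 2]].

Definition complete_pattern n : pattern := mkseq (iota 0) n.

Lemma padj_complete n i j :
  i < n -> j < n -> padj (complete_pattern n) i j = (i != j).
Proof.
move=> lti ltj; rewrite /padj /complete_pattern !nth_mkseq // !mem_iota !add0n /=.
by case: ltngtP.
Qed.

Lemma occurs_path6 (G : sgraph) (f : nat -> G) :
  occurs_at path6 f -> contains G (path_graph 6).
Proof.
move=> fP; apply: (@occurs_contains _ (path_graph 6) _ _ (@nat_of_ord 6) fP) => //.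
  exact: val_inj.
by move=> [[|[|[|[|[|[|//]]]]]] ?] [[|[|[|[|[|[|//]]]]]] ?].
Qed.

Lemma occurs_diamond (G : sgraph) (f : nat -> G) :
  occurs_at diamond_pattern f -> contains G diamond.
Proof.
move=> fP; apply: (@occurs_contains _ diamond _ _ (@nat_of_ord 4) fP) => //.
  exact: val_inj.
(* Equality of the two edges as sets is turned into mutual inclusion, hence into equalities of
   vertices, which compute in each of the 16 cases. *)
move=> i j; rewrite /= /del_edge_adj eqEsubset !subUset !sub1set !inE.
by move: i j => [[|[|[|[|//]]]] ?] [[|[|[|[|//]]]] ?].
Qed.

(** For n = 6 this lets K6 join the excluded patterns: an occurrence would give a clique number of
    at least 6. *)
Lemma occurs_complete (G : sgraph) n (f : nat -> G) :
  occurs_at (complete_pattern n) f -> n <= clique_number G.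
Proof.
rewrite /occurs_at size_mkseq => -[f_inj fP].
pose K := [set f i | i : 'I_n].
suff K_clique : is_clique K.
  have <- : #|K| = n.
    rewrite card_imset ?card_ord // => i j /f_inj ij.
    by apply/val_inj/ij; apply: ltn_ord.
  by rewrite /clique_number; apply: (leq_bigmax_cond (F := fun S : {set G} => #|S|)).
apply/forall_inP=> _ /imsetP[i _ ->]; apply/forall_inP=> _ /imsetP[j _ ->].
apply/implyP=> ij; rewrite fP ?inE // padj_complete //.
by apply: contra_neq ij => ->.
Qed.

(** Enumerating a largest clique gives the copy. Positivity makes that clique nonempty and so
    provides a default vertex for the total map [f]. *)
Lemma clique_number_occurs (G : sgraph) : 0 < clique_number G ->
  exists f : nat -> G, occurs_at (complete_pattern (clique_number G)) f.
Proof.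
rewrite /clique_number; have [|K K_clique ->] :=
    @eq_bigmax_cond _ (@is_clique G) (fun K : {set G} => #|K|).
  apply/card_gt0P; exists set0; apply/forall_inP=> x; rewrite inE //.
case/card_gt0P=> x0 _; exists (nth x0 (enum K)).
have K_nth i : i < #|K| -> nth x0 (enum K) i \in K.
  by move=> lti; rewrite -mem_enum mem_nth -?cardE.
have nth_K i j : i < #|K| -> j < #|K| ->
    (nth x0 (enum K) i == nth x0 (enum K) j) = (i == j).
  by move=> lti ltj; rewrite nth_uniq -?cardE ?enum_uniq.
rewrite /occurs_at size_mkseq; split=> i j; rewrite !inE => lti ltj.
  by move/eqP; rewrite nth_K // => /eqP.
rewrite padj_complete //; have [->|ij] := eqVneq i j; first exact: adj_irr.
move/forall_inP: K_clique => /(_ _ (K_nth _ lti))/forall_inP/(_ _ (K_nth _ ltj)).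
by rewrite nth_K // ij.
Qed.

(** * Reading the certificate *)

(* An entry reads "pattern | reducer | tree". The vertices 0, 1, ... are written
   a, b, ...; the i-th word of the pattern lists the neighbours of vertex i that
   are smaller than i (vertex 0 has none and is omitted). The reducer starts
   with H (72), D (68) or C (67). Trees are in prefix notation: an uppercase letter
   is a [Node], "-" is [Vac], and a lowercase word is a [Leaf] whose first two
   letters are its pattern number in base 26. This reader is only run when the
   literals are parsed, and nothing is proved of it. *)

Definition split (T : Type) (sep : pred T) (s : seq T) : seq (seq T) :=
  foldr (fun x ss =>
    if sep x then [::] :: ss else (x :: head [::] ss) :: behead ss) [:: [::]] s.

(** Bytes up to 32 separate words, so the line breaks inside a literal count as blanks; empty words,
    caused by runs of blanks, are dropped. *)
Definition words (s : seq nat) : seq (seq nat) :=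
  filter (fun w => w != [::]) (split (geq 32) s).

(** The code of the letter a is 97. *)
Definition letters (w : seq nat) : seq nat := map (subn^~ 97) w.

Definition read_reducer (ws : seq (seq nat)) : option reducer :=
  match ws with
  | [:: 72] :: ps =>
      Some (Hom (pmap (fun w =>
        if letters w is [:: a; b] then Some (a, b) else None) ps))
  | [:: [:: 68]; [:: v]] => Some (Deg (v - 97))
  | [:: [:: 67]; cs] => Some (Col (letters cs))
  | _ => None
  end.

Definition push_leaf (w : seq nat) (ts : seq tree) : seq tree :=
  if letters w is a :: b :: s then Leaf (a * 26 + b) s :: ts else ts.

(** Prefix notation is read from right to left with a stack, so a node finds its two subtrees
    complete, the left one (adjacent case) on top. The word [w] collects lowercase letters until
    another symbol turns it into a leaf. The codes 65 and 45 are those of A and of the hyphen. *)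
Definition read_tree (s : seq nat) : option tree :=
  let step x wts :=
    let: (w, ts) := wts in
    if 97 <= x then (x :: w, ts) else
    ([::], match push_leaf w ts with
           | t1 :: t0 :: ts' =>
               if 65 <= x then Node (x - 65) t1 t0 :: ts'
               else if x == 45 then [:: Vac, t1, t0 & ts'] else [:: t1, t0 & ts']
           | ts' => if x == 45 then Vac :: ts' else ts'
           end) in
  let: (w, ts) := foldr step ([::], [::]) s in ohead (push_leaf w ts).

Definition read_entry (bs : seq Byte.byte) : option entry :=
  match split (pred1 124) (map Byte.to_nat bs) with
  | [:: p; r; t] =>
      match read_reducer (words r), read_tree t with
      | Some r', Some t' => Some (Entry ([::] :: map letters (words p)) r' t')
      | _, _ => None
      end
  | _ => None
  end.

(** [String Notation] asks for a printer as well; this one always declines. *)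
Definition print_entry (e : entry) : option (seq Byte.byte) := None.

Declare Scope entry_scope.
Delimit Scope entry_scope with entry.
String Notation entry read_entry print_entry : entry_scope.
Bind Scope entry_scope with entry.

(** * The certificate and the conclusion *)

Definition forbidden : seq pattern :=
  [:: path6; diamond_pattern; complete_pattern 6].

(* Patterns are numbered from 0: first the three of [forbidden], then those of the
   entries. The last entry is K5. *)
Definition certificate : seq entry :=
  [:: "a ab abc abcd e bf cfg dfgh afghi af | H ke | KE-ABablabe Cablacb Dabladb Fabalkf Jabjlak GHablghf aalkfhcb
     aalkfgbc GFabglfk Hablghf aahglkae Haaghlkae BCablbca aalkachg aalkabgh -";
    "a ab abc abcd e bf cfg dfgh afghi ef efk efkl | D m | MEFKLacnefklm abnefl abnefk abnemf Fabnfme Kabnkme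
     Labnlme ABabnabe Cabnacb Dabnadb Gaacangfk aanabgfk JGabngjf Habnhjf Iabnijf Baahjnbek aanjgbek Baanbajfk
     aanmfjab -";
    "a ab abc abcd e bf cfg dfgh afghi ef efk | D l | LEFKAabamef Babmbea Cabmcea Dabmdea Gabemfg Habmfhg Iabmfig
     Jabmfjg aeabcdefghijmkl abmefk abmelf Fabmfle Kabmkle ABabmabe Cabmacb Dabmadb Gaacamgfk aamabgfk JGabmgjf
     Habmhjf Iabmijf Baahjmbek aamjgbek Baambajfk aamlfjab -";
    "a ab abc abcd e bf cfg dfgh afghi ef | D k | KEFAabalef Bablbea Cablcea Dabldea Gabelfg Hablfhg Iablfig
     Jablfjg afabcdefghijlk ablekf Fablfke ABablabe Cablacb Dabladb GHablghf aalkfhcb aalkfgbc GHablghf aahglkea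
     BCablbca Dablbda Haaghlkea aalkfhca aalkfgba -";
    "a ab abc abcd e bf cfg dfgh afghi a ak akl aklm | D k | KALMNacoaklmn aboakn aboakm aboakl Labokla Mabokma
     Nabokna GCBabobca Dabocda aalkogbd HFIJacofghij abofgj abofgi aboghf aaoghcal BCabobca Dabobda Eabobea
     Faagfokac aaokaefg Faaofgbal aaokabgf -";
    "a ab abc abcd e bf cfg dfgh afghi a ak akl | D m | MAKLBabbnak Cabnacb Dabnadb Eabnaeb Jabjnak IFabnfij
     aaknifeb Faaknfidb Gaakngfec Haaknhfeb ahabcdefghijnklm abnakl abnamk Kabnkma Labnlma EBabnbea Cabncea Dabndea
     Gaakmngbc aakmnebg FBCabnbca aakmnfec aakmnfeb Gaangfeak aanmaefg -";
    "a ab abc abcd e bf cfg dfgh afghi a ak | D l | LAKBabbmak Cabmacb Dabmadb Eabmaeb Jabjmak FGabmfgj aakmfgbc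
     Gaakmgfec Haakmhfeb Iaakmifeb aiabcdefghijmkl abmalk Kabmkla FGHIJacmfghij abmfgj abmfgi abmfgh Habmfhg
     Iabmfig Jabmfjg Baahfmbak aamfgbak EBabmbea Cabmcea Dabmdea Gaafgmlac aamlabgf Gaamgfeak aamlaefg -";
    "a ab abc abcd e bf cfg dfgh afghi a | H kc | KC-ABablabc Dabladb Eablaeb Jabjlak FGablfgj aaklfgbc Gaaklgfec
     Haaklhfeb Iaaklifeb ajabcdefghijlk FGHIJaclfghij ablfgj ablfgi ablfgh aagflkac HGablghf Iablhif Jablhjf
     BDablbda aalkadif aalkabgf aalkachf -";
    "a ab abc abcd e bf cfg dfgh afghi | C abcdeacbed | ABCDEackabcde abkabe abkabd abkabc Cabkacb Dabkadb Eabkaeb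
     JFabakjf Gabkgjf Habkhjf Iabkijf agbcdeajhifgk FGabkfgj Habkfhg Iabkfig adabcdefghijk GHabkghf Iabkgif
     adacdebghifjk HIabkhif adabdechgifjk Iadabcedighfjk akabcdefghijk FGHIJackfghij abkfgj abkfgi abkfgh Habkfhg
     Iabkfig Jabkfjg EBabkbea Cabkcea Dabkdea agabcdefghijk BCabkbca Dabkbda adbacdefjhigk CDabkcda adcabdefjgihk
     Daddabcefjghik akfghijabcdek BCabkbca Dabkbda Eabkbea GHabkghf Iabkgif Jabkgjf agacdebghifjk HIabkhif Jabkhjf
     adbadechjifgk IJabkijf adbacedijhfgk Jadbcdeajhifgk akbacdefjhigk HGabkghf Iabkhif Jabkhjf CDabkcda Eabkcea
     agabdechgifjk DEabkdea addabechjgfik Eadeabdchjgifk akhfgijaebdck DCabkcda Eabkdea IGabkgif Jabkijf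
     agabcedighfjk GJabkgjf addacebgjhfik Jaddbceajghfik akdabcefjghik GIabkgif Jabkgjf CEabkcea adcadebgjifhk
     Eadeacdbgjhifk akgfhijaecdbk CEabkcea IJabkijf adcabedijgfhk Jadcbdeajgifhk akcabdefjgihk IJabkijf
     Eadeabcdijghfk akifghjaebcdk EJadebcdajghifk akeabcdijghfk Jakjfghidebcak -";
    "a ab abc abcd e bf cfg dfgh af | H je | JE-ABabkabe Cabkacb Dabkadb Fabakjf GHabkghf aakjfhcb aakjfgbc
     GFabgkfj Habkghf aahgkjae Haaghkjae BCabkbca aakjachg aakjabgh -";
    "a ab abc abcd e bf cfg dfgh a fghij | D j | JABabblaj Cablacb Dabladb Eablaeb Kabaljk FGablfgk aaljkgbc
     aaljkfeb BCablbca Dablbda Eablbea HGabblgh aaghljad Faahfljad aaljachf IKabilkj Fablfik aafiljab GFablfgi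
     Hablghf Kablgkf Caabcljkf aaljachf aaljabgi -";
    "a ab abc abcd e bf cfg dfgh a aj fghi | D l | LFGHIacmfghil abmfgi abmfgh abmflg Gabmglf Habmhlf Iabmilf
     JBAabbmaj Cabmbca aamjachf ACabmacb aajmlgbc aamjabgf AKabmakj BCDEacmabcde abmabe abmabd abmabc Cabmacb
     Dabmadb Eabmaeb anabcdefghiml Eaaglmeaj aamlfeaj -";
    "a ab abc abcd e bf cfg dfgh a aj | D i | IFGHBabblgf Eabelfg Cabclhf Dabdlif Aallfghidebca Janlfghidebcja
     Kaajklfeb aoabcdefghijkl ablfgh ablfig Gablgif Hablhif ADabaldi Bablabd Cablacb Eablaeb amabcedighfl JKabljka
     Eaagileak aalifeak Eaagileaj aalifeaj -";
    "a ab abc abcd e bf cfg dfgh a | H jb | JB-ACabkacb Dabkadb Eabkaeb FGHIalkfghidebca abkfgi abkfgh aajkfgbc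
     Gaajkgfec Haajkhfeb Iaajkifeb apabcdefghikj FHGIEabekfg Cabckhf Dabdkif ankfghidebcja abkfgi abkfhg aahfkjab
     GHabkghf Iabkgif CDabkcda aakjadif aakjachf aakjabgf -";
    "a ab abc abcd e bf cfg dfgh | D a | ABCDEacjabcde abjabe abjabd abjabc Cabjacb Dabjadb Eabjaeb
     FGHIaljfghidebca abjfgi abjfgh Habjfhg Iabjfig amabcdefghij GHabjghf Iabjgif amacdebghifj HIabjhif
     amabdechgifj Iamabcedighfj aqabcdefghij -";
    "a ab abc abcd e bf cfg df | H ie | IE-DAabjade Babjbda Cabjcda Fabdjif GHabjghf aajifhca aajifgba GFabgjfi
     Habjghf aahgjide Haaghjide BAabjabd Cabjbca aajidchg aajidbgh -";
    "a ab abc abcd e bf cfg d a fghij | D j | JABabblaj Cablacb Dabladb Eablaeb Kabaljk FGablfgk aaljkgbc aaljkfeb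
     GKabglkj Fablfgk Hablghf CBablbca aabcljkf aaljachf BCablbca Dablbda Eablbea Faagfljac aaljaefg FHablfhg
     aaljabgh aaljabgf -";
    "a ab abc abcd e bf cfg d a di fgh dik dikm | D n | NDIKMacodikmn abodim abodik abodni Iaboind Kaboknd Mabomnd
     HABaboabd Caboacb aainohcb Jaahojadi aahondaj CAaboacd Babobca Eabocea Faahfonda aaondefh Faaofhcdi aaondchf -";
    "a ab abc abcd e bf cfg d a di fgh dik | D m | MDIKAabandi Babnbda Cabncda Eabndea GFHarabcednghf abnfgh
     aaingfea Faainfgba Haainhfea Jaanjabgf Laanlfeaj auabcdefghnjilkm abndik abndmi Iabnimd Kabnkmd GABabnabd
     Cabnacb aaimngbc Jaagnjadi aagnmdaj HFabnfhg Labnhlf Eaaghnedi aanhfedi Baaimnbgh aanmdbgh -";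
    "a ab abc abcd e bf cfg d a di fgh | D i | IDKAabamdi Babmbda Cabmcda Eabmdea FGHarabcedmghf abmfgh aaimfgba
     Gaaimgfea Haaimhfea Jaamjabgf Laamlfeaj avabcdefghmjilk abmdik Kabmikd BAabmabd Cabmbca Eabmbea Faakimfea
     aakimbef GACabmacb aakimgbc aakimgba Faamfgbdk aamidbgf -";
    "a ab abc abcd e bf cfg d a di | D g | GABabalbg Cablacb Dabladb Eablaeb HFardbcealghf ablghf Fablfgh
     asdceabghfl FHBabblgf Eabelfg Cabclhf Darabcedlghf KIablikd aaiklfea Iaakilfea Jaafljadi awabcdefghijkl ablfgh
     Hablghf DBablbda Cablcda Eabldea asacedbghfl Iaafglida Eaahgledi aalgfedi -";
    "a ab abc abcd e bf cfg d a | H jd | JD-ABabkabd Cabkacb Eabkaeb FGHardbceakghf abkfgh aajkfgbc Gaajkgfec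
     Iaakidbgf Haakhfedi axdbcaefghkij FGHBabbkgf Eabekfg Cabckhf Iatabcdefghijk aafkjadi abkfgh aagfkjad Gaafgkjad
     BCabkbca Eabkbea aakjaefg aakjabgf -";
    "a ab abc abcd e bf cfg d | D a | AEBCDacjabcde abjabd abjabc abjaeb Babjabe Cabjacb Dabjadb HFGardbceajghf
     abjfhg Gabjghf asdbeachgfj IFaaijfhcb aajidchf Faajfhcdi Gaajgfedi aydbcaefghji -";
    "a ab abc abcd e bf cfg | D d | DBACEaciabcde abiabe abiabc abibda Aabiadb Cabicda Eabidea FGHarabcedighf
     abifgh Habifhg asabcdefghi GHabighf asacedbghfi Hasabedchgfi azabcdefghi -";
    "a ab abc abcd e bf cf agh dgh agh afjk afij | H ki lm | LKABabbnak Cabnacb Dabnadb Eabnaeb Gabankg Habankh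
     Iabinak Fabanlf aanabgfh abnkla M-Aabnalk CBabnbca Dabncda Eabncea GFabgnfl aangfmad aanlkgbd GFabgnfl
     aangfmac Faanfgkac Daandakgf Haanhfmad aanlfhcd KI-Aabnakl JGabjngk Habjnhk CBabnbca aanjhiab aanjgiac
     MEBabnbea aabenklj Gaangjlae Caancaigj Faanfgiac aankgfec aankljmi -";
    "a ab abc abcd e bf cf agh dgh agh afjk | H ik | IK-GAabamig Babbmgi Fabfmgi Habgmih Jabimgj Daamdakhf aamihjdb
     DAabdmai Babmbda Cabmcda aacdmigk Caadcmigk JHabimhj Eaamechkg FLabfmlj Baambchkl Abbadebchjfmglki aamfgkac
     aamigfec aamigjdc -";
    "a ab abc abcd e bf cf agh dgh agh | H ki | KI-HAabalkh Cabclhk Fabflhk Gabglkh Jabjlhk Daaldaigf aalkgjdc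
     EAabelak Bablbea aabelkhi Baaeblkhi FGabflgk Daaldbgih ACablacb Jbcabcdefghijkl aalabgjh aalfgiad aalkhfeb -";
    "a ab abc abcd e bf cf agh dgh bgh afijk dfijk efijk cghlmn ghlmn | H pi | PI-ENabeqnp Fabqefn BACDacqabcde
     abqabd abqabc abqbea Aabqaeb aaqpniab LAabqali Fabfqlp Gabgqpl aaqpgfea Baaebqpli FNabqfne Gabfqgp Habfqhp
     Mabfqmp Caaqcbgil Daaqdbgih AJbdadebchjfqgl aaqabgjh aaqfgiac aaqplfeb -";
    "a ab abc abcd e bf cf agh dgh bgh afijk dfijk efijk cghlmn | C abcdeacbdaabbba | DCABEacpabcde abpabe abpacb
     abpcda Aabpadc Babpbda Eabpdea KGabpgkb Mabdpmk Jabpdjm Haaphjgba FLabfplk bddbeachkfplm aapdbgfh LIabpila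
     Jabdpjl Mabpdmj GFabgpfl Oabgpol bddabceflgpoj aapdaigk Faapflkbc aapdbklf ABabpabd Cabpacb Eabpaeb JLabaplj
     Iabpail Mabpjmd Gaapgimdc FHabfphj bdadebchjfpgl aapabgfm NFabpfne Iabapin Labpali GKabpgkb Oabgpon
     bdabecdjgnpoi aapadjgf Faapfnjdb aapadjnf MJabpjmd EBabpbea Cabpcea Fabepfm Nabpenf Iaapinjdb GKabpgkb Oabgpom
     bdebdacogmpif aapeaigj LIabpila Fablpfm Kablpkm Oablpom NCBabpbca bdcadbeflmpko HBbdbacdeflhpjk
     Gbeabcdefghijklmnop aaphfgba aaplfhcd aaplined aapmjlae CBabpbca Eabpcea FHabcphf Nabpfne Oabpcoh IGabfpgi
     bdcaebdmifpgh aapcdmin Gaapgfmda aapcbgfm OHabphoc ILabpila Gabipgo Nabipno JBEabpbea bdbadcenijphg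
     KEbdeadbchijpgn Fbedeabchfimgnjkolp aapigfec aapihkbd aapigjdc aapohiad Faapfmoca Baapbcomf Gaapgfmda
     Eaapebgom Haaphfgba Iaapigfec Jaapjgfea Kaapkgfea Laaplfgbc Naapnfgba -";
    "a ab abc abcd e bf cf agh dgh bgh afijk dfijk efijk cglmn ghlmn | H pi | PI-ENabeqnp Fabqefn BACDacqabcde
     abqabd abqabc abqbea Aabqaeb aaqpniab LAabqali Fabfqlp Gabgqpl aaqpgfea Baaebqpli FNabqfne Gabfqgp Habfqhp
     Mabfqmp Caaqcbgil Daaqdbgih AJbdadebchjfqgl aaqabgjh aaqfgiac aaqplfeb -";
    "a ab abc abcd e bf cf agh dgh bgh afijk dfijk efijk cglmn | C abcdeacbdaabbba | CBADEacpabcde abpabe abpabd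
     abpbca Aabpacb Dabpcda Eabpcea GKabpgkb Oabcpog LFabgpfl Iabpila Jabgpjl bdcabdeflgpjo aapgklad JHabcphj
     Mabpjmd FLabfplj bdcdeabgjfplh aapcbgfm Faapfgjda aapcdjgf DAabpadc Babpbda Eabpdea KGabpgkb Mabdpmk Jabpdjm
     Haaphjgba FLabfplk bddbeachkfplm aapdbgfh HJabdpjh Mabpdmj Faapfmkba GIabgpih bddbcaefghpij aapdefgk Faapfhkba
     aapdbkhf JMabpjmd BAabpabc Eabpbea Gabbpgj Kabpbkg Haaphkmda FLabfplj bdbdeachjfplg aapbchfm KGabpgkb Habjphk
     Labjplk Nabjpnk OEAabpaeb bdebdachkjpln FAbdadebchjfpgl Ibgaecdbgfolmnijkhp aapfgiac aapjgfec aapjlocb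
     aapjmkbc ABabpabc Eabpaeb NFabpfne Iabapin Labpali GKabpgkb Oabgpon bdabecdjgnpoi aapadjgf Faapfnjdb aapadjnf
     LIabpila HFabhpfl Kabhpkl MOablpom EBabpbea bdeacbdjlhpkf NBbdbacdeflhpjk Gbgabcdefghijklmnop aaphfgba
     aaphined aaphfmda aaplihcd Faapfljdc Baapbdjlf Gaapgflac Eaapealjg Haaphfgba Iaapigfec Kaapkgfea Maapmfgba
     Naapnfgba Oaapogfea -";
    "a ab abc abcd e bf cf agh dgh bgh afijk dfijk efijk ghlmn | H oi | OI-CHabcpho BADEacpabcde abpabe abpabd
     abpbca Aabpacb aapohiab NEabepno Fabpfne Gabgpon aapogfec ABabpabc Dabpadb Eabpaeb Labpali Gaapginec FHabfpho
     Mabfpmo Jbdadebchjfpgl aapabgjh aapabgfn aaponiac -";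
    "a ab abc abcd e bf cf agh dgh bgh afijk dfijk efijk fijk | H og | OG-FEabepfo Nabpfne Habhpfo Iabfpoi Jabfpoj
     Kabfpok Lablpfo Mabmpfo Aaapaenjg aapojlae CABDEacpabcde abpabe abpabd abpacb aaacpofg BAabpabc Dabpbda
     Eabpbea Kabpbkg Iaapigfec HJabhpjo Lbdbacdeflhpjk aapbefli aapbaihf aapofgbc -";
    "a ab abc abcd e bf cf agh dgh bgh afijk dfijk efijk | C abcdeacbdaabbb | ABCDEacoabcde aboabe aboabd aboabc
     Caboacb Daboadb Eaboaeb FLabaolf Iaboail Nabofne JGabfogj Habfohj bdadebchjfogl aaofljdb HIabaoih Laboali
     GJabgojh bdabcdefghoji aaohfgbd Gaaogfhcd aaoabgfh CBabobca Dabocda Eabocea FHabcohf Nabofne IGabfogi Laboila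
     Mabfomi bdcaebdmifogh aaofhiab GKabogkb LIaboila Jabgojl MNHbfabdecogmifklnhj bhabcdenkolmgijfh aaocainf
     aaocaimf aaocbklf Iaaoigfed aaocaigf LIaboila BDabobda Eabobea Kabbokl Gabobgk Faaofgiac HJabhojl
     bdbacdeflhojk aaobaihf GKabogkb Fabgofl Jabgojl HDEabodea bddbcaefghoij MEbdebcadjghoif Nbiabcdefghijklmno
     aaoginec aaogfmda aaogfhca aaoligbc FJGabfogj Habfohj Mabfomj Dabodjm Nabfonj Eaboefn IBbdbaecdmifohg
     Kbjabcdefghijklmno aaofhkba aaofgiac DBabobda Eabodea Mabodmj Nabofne IGabfogi Habfohi bddaebchifogm aaodenil
     aaofljdc Gaaogflac Daaodalfg Haaohflad Baaobalfh Maaomfgba Naaonfgba EIJbdeadbchijogn aaoebgjh aaoebgih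
     Iaaoigfec Jaaojgfea Kaaokgfea -";
    "a ab abc abcd e bf cf agh dgh bgh afijk dfijk eijk cglmn ghlmn | H pi | PI-ENabeqnp DABCacqabcde abqabc abqadb
     abqdea Aabqaed aaqpniad GBabbqgp Kabqgkb Fabfqgp Habgqph aaqphfeb ABabqabe Cabqacb Dabqadb Labqali Haaqhigbd
     FMabfqmp Jbdadebchjfqgl aaqabgjh aaqabgfh aaqpgiae -";
    "a ab abc abcd e bf cf agh dgh bgh afijk dfijk eijk cglmn | C abcdeacbdaabbba | ACBDEacpabcde abpabe abpabd
     abpacb Babpabc Dabpadb Eabpaeb GIabapig Kabpgkb Labpali Faapflkbc HJabgpjh bdabcdefghpji aapabkhf JLabaplj
     Iabpail Mabpjmd FHabfphj bdadebchjfpgl aapabgfm Faapfgjdc aapadjgf BCabpbca Dabpbda Eabpbea IGabbpgi Kabpbkg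
     Labpila Haaphklad FMabfpmi bdbaecdmifphg aapbalfh MJabpjmd Kabbpkm Gabpbgk HFabhpfm bdbcdaefhmpik aapbaihj
     Faapfmiac aapbaimf LIabpila GKabpgkb Fabgpfl Jabgpjl Oabgpol CDabpcda Eabpcea bdcabdeflgpjo HEDabpdea
     bdebcadjghpif NDbddbcaefghpij Mblabcdefghijklmnop aapgfmda aapginec aapgfhca CDabpcda aapligbd aapligbc
     CDabpcda Eabpcea JHabcphj Mabpjmd FGabfpgj bdcdeabgjfplh aapcalfm Faapfljdb aapcdjlf KGabpgkb IHabiphk Mabipmk
     Nabipnk OEDabpdea bdeabcdmikphn FDbddaebchifpgm Jbldacbeniomgljkfhp aapfgjda aapigfec aapilocb aapkgiac
     Faapflkbc Daapdbklf Gaapgflac Eaapealkg Haaphfgba Iaapigfec Jaapjgfea Maapmfgba Naapnigbc Oaapogfea -";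
    "a ab abc abcd e bf cf agh dgh bgh afijk dfijk eijk ghlmn | H oi | OI-ENabepno DABCacpabcde abpabc abpadb
     abpdea Aabpaed aaponiad MDabdpmo Jabpjmd Fabfpmo Gabgpom aapogfed ABabpabe Cabpacb Dabpadb Labpali Gaapgimdc
     FHabfpho Jbdadebchjfpgl aapabgjh aapabgfm aapomiae -";
    "a ab abc abcd e bf cf agh dgh bgh afijk dfijk eijk | D n | NAEabaoen Baboabe Caboacb Daboadb Iabaoin Laboali
     GKabogkb Jabgojn Hbdacebdjhnoki aaoabkhj aaonigbc JDabdojn Mabojmd Eabeonj Gabgojn Habhojn Iabionj aaojgiae
     CBabobca Dabocda Eabocea GKabogkb Iabgoin LFabgofl MHbkacebdmoflghikj bmabedcognijklmhf aaocaimf aaocdjli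
     aaonjgba HIabhoin Kabhokn LFabhofl BDabobda Eabobea bdbacdeflhojk GDEabodea bddbcaefghoij MEbdebcadjghoif
     bnabcdefghijklmno aaogfmda aaohfgba aaonjlac aaonjhca -";
    "a ab abc abcd e bf cf agh dgh bgh afijk dfijk fijk | H nh | NH-AIabaoin Laboali EBCDacoabcde aboabd aboabc
     aboaeb Baboabe Caboacb aaonihcb JDabdojn Mabojmd Fabfonj aaonfmda CBabobca Dabocda Eabocea Faaofhjda GKabogkb
     Iabgoin LMboabedchkflmgijo aaocaimf aaocefli aaocdjgf aaonjhca -";
    "a ab abc abcd e bf cf agh dgh bgh afijk dfijk | C abcdeacbdaabb | BACDEacnabcde abnabe abnabd abnabc Cabnbca
     Dabnbda Eabnbea HKabbnkh Gabnbgk LFabhnfl Iabnila Jabhnjl bdbacdeflhnjk aanhklad IGabbngi Kabnbkg Labnila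
     FMabfnmi bdbaecdmifnhg aanbalfh Faanfhiad aanbaihf CAabnacb Dabncda Eabncea FHabcnhf IGabfngi Labnila Mabfnmi
     bdcaebdmifngh aanfhiab GKabngkb LIabnila Jabgnjl MHbkacebdmnflghikj boabedchkflmgijn aancaimf aancbklf
     Iaanigfed aancaigf DAabnadb Eabndea HJabdnjh Mabndmj GFabgnfh Iabgnih bddbcaefghnij aanhjgba KGabngkb Mabdnmk
     Jabndjm FLabfnlk bddbeachkfnlm aandbgfh Faanfhkba aandbkhf MJabnjmd GKabngkb Fabgnfm Iabgnim HAEabnaeb
     bdabcdefghnji LEbdebcadjghnif bpabedchkflmgijn aangflac aangfhcd aanmjgbc GKabngkb aangkmdc IJHabinhj Labinlj
     Aabnail KEFbkaecbdjnhikflgm boabcdefghijklmn Fbpabcdefghijklmn aanigfec aanihkbd aanigjdc Eaanebgim Haanhigbd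
     Laanligbc FAJbdadebchjfngl aanabgjh aanfgiac Aaanabgfh Jaanjgfea Kaankgfea -";
    "a ab abc abcd e bf cf agh dgh bgh afijk eijk dfik cglmn ghlmn | H pi | PI-DNabdqnp CABEacqabcde abqabe abqacb
     abqcda Aabqadc aaqpniac GBabbqgp Kabqgkb Fabfqgp Habgqph aaqphkbd ABabqabd Cabqacb Eabqaeb Labqali Haaqhigbd
     FNabfqnp Jbdadebchjfqgl aaqabgjh aaqabgfh aaqpgiad -";
    "a ab abc abcd e bf cf agh dgh bgh afijk eijk dfik cglmn | C abcdeacbdaabbba | ADBCEacpabcde abpabe abpabc
     abpadb Babpabd Cabpacb Eabpaeb KGabpgkb Labaplk Iabpail Haaphigbd FNabfpnk bdabecdnkfphl aapabgfh HIabapih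
     Labpali Faapflkbc GJabgpjh bdabcdefghpji aapaefgk Faapfhkbd aapabkhf BCabpbca Dabpbda Eabpbea LIabpila Kabbpkl
     Gabpbgk Faapfgiac HJabhpjl bdbacdeflhpjk aapbaihf FGabbpgf Kabpbkg IHabfphi Nabfpni bdbaecdnifphg aapfgiac
     Haaphflad aapbalfh ILabpila KGabpgkb Habiphk Mabipmk Nabipnk DCabpcda Eabpdea bddabcemikphn JCEabpcea
     bdcadbemijpgh OEbdeadbchijpgm Fbrbacdemiognlkfjhp aapigfec aapigocd aapihjdb CDabpcda aapilkbd aapilkbc
     CDabpcda Eabpcea GKabpgkb Oabcpog LFabgpfl Jabgpjl bdcabdeflgpjo aapcbkli Faapfgiad aapcaigf GKabpgkb HFabgpfh
     Jabgpjh LOabgpol DEabpdea bddbcaefghpij NEbdebcadjghpif Mbrabcdefghijklmnop aapgimec aapgfnda aapgflac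
     aapgkhca Faapfgiac Daapdaigf Haaphfgba Eaapebgih Jaapjgfea Kaapkgfea Laaplfgbc Maapmigbc Naapnfgba Oaapogfea -";
    "a ab abc abcd e bf cf agh dgh bgh afijk eijk dfik ghlmn | H oi | OI-EMabepmo CABDacpabcde abpabd abpacb abpcea
     Aabpaec aapomiac LAabpali Fabfplo Gabgpol aapogfea Baaebpoli FGabfpgo Habfpho Nabfpno Caapcbgil Daapdbgih
     AJbdadebchjfpgl aapabgjh aapfgiac aapolfeb -";
    "a ab abc abcd e bf cf agh dgh bgh afijk eijk dfik | D n | NEDabeodn Aaboaed Babobea Cabocea Fabeofn GKabogkb
     Iabgoin Hbdecdabkhnoif aaoeaihk aaonfgba IAabaoin Laboila Dabdoni Fabfoni aaoilfed CAaboace Babobca Dabocda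
     GKabogkb Fabgofn LJabgojl MHbqacdbemojlghik bsabdecognifklhmj aaocaimj aaocefli aaonigbe HFabhofn Kabhokn
     MJabhojm ABaboabc Daboadb bdacebdjhmoki LBDabobda bdbacdeflhojk GDbddbcaefghoij btabcdefghijklmno aaohfgba
     aaohjlae aaonimec aaonihce -";
    "a ab abc abcd e bf cf agh dgh bgh afijk eijk fijk | H ng | NG-CEABDacoabcde aboabd aboacb abocea Aaboace
     Babobca Dabocda FHabcohf Iabfoni aaofgiad aaonfgba KBabobkg Fabfonk aaonfgbc Aaacaonkg HFabhofn Iabhoin
     Jabhojn Daaodaigf Eaaoeaigj BLbdbacdeflhojk aaobefli aaohfgba aaonkhca -";
    "a ab abc abcd e bf cf agh dgh bgh afijk eijk | D f | FDEabdnef Aabnade Babnbda Cabncda Gbaabecdngf IHabfnhi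
     Labnila KMabinmk Jbqadcbefnhikjlg buabcedjghifklnm aandchkg aanfgiac CAabnacd Babnbca Eabncea Habcnhf IGabfngi
     Labnila Jbdcdeabgjfnlh aancaljg aanfhiab JGabfngj Habfnhj Labfnlj Maamnfhcd ABabnabc Eabnaeb bdadebchjfngl
     IBEabnbea bdbdeachjfnlg KEbdeadbchijngm bvabcdefghijklmn aanfhkba aanfgiac GBabbngf Eabenfg Habgnfh aanfhjdb
     aanfgjdc -";
    "a ab abc abcd e bf cf agh dgh bgh afijk fijk | H mg | MG-AIabanim Labnali DBCEacnabcde abnabe abnabc abnadb
     Babnabd aanmigbd KBabnbkg Fabfnmk aanmfgba Caaacnmkg HFabhnfm Iabhnim Jabhnjm Daandaigf Eaaneaigj
     BLbdbacdeflhnjk aanbefli aanhfgba aanmkhca -";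
    "a ab abc abcd e bf cf agh dgh bgh afijk | D i | IDAabdmai Babmbda Cabmcda Eabmdea Labmila FGabfmgi Habfmhi
     KJbqadcbefmhikjlg bwabecdmkflhgij aamdchkg aamilfeb EAabmaed Babmbea Cabmcea Labmila JGabimgj Habimhj
     KFbqaecbdjmhikflg bwabdcemkjlhgif aamechkg aamiljdb FGabfmgi Habfmhi Labfmli Aabmail JBCabmbca bdbdeachjfmlg
     KCbdcdeabgjfmlh bxabcdefghijklm aamfhkba aamfgjda GAabamig Babbmgi Habgmih aamihfeb aamigfed -";
    "a ab abc abcd e bf cf agh dgh bgh cfijk cgh cgl | H hl mn | HCMAabaoch Babobca Dabocda Eabocea Fabcohf Iabcohi
     Jabcohj Kabcohk Labhocl Gabcomg aaocaigf abochm Mabohmc L-GFabgofh Iabgoih Jabgojh Kabgokh Babobgk Aaaoabklf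
     aaogflca NDAaboadc aaadohmg Faaofgmcd Aaaoaclfg Baaabohfl aaohfgba aaohmgnl MN-Cabocmh GBabbogm Kabogkb
     Fabfogm Iabiogm Jabjogm Aaaoabkhf aaogfhca EAaboaec aaaeomgn Iaaoignce Daaodchig Faaofgncd aaomgfed -";
    "a ab abc abcd e bf cf agh dgh bgh cfijk cgh | H lh | LH-BCabbncl Aabnabc Dabnbda Eabnbea Kabbnkl Gabnbgk
     Fbaacedbnlf aaabnlfh FCabcnlf Eabenfl Gabgnfl Iabfnli aanligbe Aaabanlfh GKabngkb Iabgnil Jabgnjl Daandaihf
     Eaaneaihj CMabncmh bzabcdefglijkhnm aangfhca aanlfgba -";
    "a ab abc abcd e bf cf agh dgh bgh cfijk | H hl | HL-ECabemch Aabmaec Babmbea Dabmdea Fabemfh Gaamgflca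
     aamhfgba IAabamih Cabcmhi Fabfmhi Gabgmih aamigfec Baaebmhil GFabgmfh Jabgmjh Kabmgkb Aaamaeflj Daamdailf
     Ccaabcdefghijklm aamgflca aamhigbe -";
    "a ab abc abcd e bf cf agh dgh bgh bfij bhl | H gl km | GBKAabanbg Cabnbca Dabnbda Eabnbea Fabbngf Iabbngi
     Jabbngj Habbnkh aanbaihf abnbgk Kabngkb L-HFabgnfh Iabgnih Jabgnjh ACabnacb aacangfl aanhflba MDAabnadb
     aaadngkh Faanfhkbd Aaanabkhf Caaacngfl aangfhca aangkhml KM-Babnbkg HCabcnhk Fabfnhk Iabinhk Jabjnhk Aaacankgf
     aanhfgba DAabnadb aaadnkhm Faanfhmbd Aaanabgfh Iaanihmbd aankgiad -";
    "a ab abc abcd e bf cf agh dgh bgh bfij | H lg | LG-CBabcmbl Aabmacb Dabmcda Eabmcea Fbaabedcmlf aaacmlfg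
     JBabbmlj Dabdmjl Fabfmlj Habhmjl aamlfhcd Aaacamljg HFabhmfl Iabhmil Daamdaigf Eaameaigj BKabmbkg
     ccabcdeflhijmgk aamhfgba aamljhca -";
    "a ab abc abcd e bf cf agh dgh bgh dfik afjk eijk cglmn ghlmn | H pk | PK-ENabeqnp CABDacqabcde abqabd abqacb
     abqcea Aabqaec Babqbea aaqpnkba GBabqbgk Fabfqgp Habgqph aaqphfeb Aaaeaqpgk FHabfqhp Labfqlp Mabfqmp Caaqcamkg
     Daaqdchkg INabiqnp JBbdbaecdlifqhg aaqfhkba aaqfgjda aaqfgiac aaqpgfea -";
    "a ab abc abcd e bf cf agh dgh bgh dfik afjk eijk cglmn | C abcdeacbdaabbba | BACDEacpabcde abpabe abpabd
     abpabc Cabpbca Dabpbda Eabpbea HKabbpkh Gabpbgk LFabhpfl Iabhpil bdbcdaefhlpik aaphklda FGabbpgf Kabpbkg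
     ILabfpli bdbaecdlifphg aapfgiac Iaapihfed aapbaihf ACabpacb Dabpadb Eabpaeb KGabpgkb Mabapmk FHabfphk Labfplk
     bdabecdlkfphm aapkgfec HIabapih GFabgpfh Jabgpjh bdabcdefghpji aaphigbd Faapfhkbd aapabkhf GKabpgkb ECabpcea
     Dabpdea Fabepfg HIabgpih Jabgpjh bdebcadjghpif aapgfhca MFabgpfm Jabgpjm Oabgpom NIabgpin DCabpcda
     bddabcefmgpoj LCbdcbdaefglpio Hceabcdefghijklmnop aapgfhca aapgflda aapgjnea aapgkmae DCabpcda Eabpdea
     ILabdpli FHabfphi bddaebchifpgl aapigfec Faapfgiac aapdaigf IMaampigbd JHabiphj Nabipnj KLabiplk CEabpcea
     bdcadbenijpgh OEbdeadbchijpgn Fceabcdenkomlgjifhp aapigfec aapigocd aapihkbd Caapcamjg aapigjdc Faapfgiad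
     Caapcaigf Haaphfgba Eaapebgih Jaapjgfea Kaapkgfea Laaplfgba Maapmfgbc Naapnigbc Oaapogfea -";
    "a ab abc abcd e bf cf agh dgh bgh dfik afjk eijk ghlmn | H ok | OK-AMabapmo CBDEacpabcde abpabe abpabd abpacb
     Babpabc aapomkbc GBabpbgk Fabfpgo Habgpoh aapohkba Caaacpogk IHabipho Labiplo Nabipno Daapdchkg Eaapechkg
     FMabfpmo JBbdbaecdlifphg aapfhkba aapfgjda aapigfec aapogiac -";
    "a ab abc abcd e bf cf agh dgh bgh dfik afjk eijk | D l | LADabaodl Baboabd Caboacb Eaboaeb Iabaoil GKabogkb
     Fabgofl Hbdacdbefhloki aaoabkhf aaoligbc KBabbokl Gabogkb Dabdolk Fabfolk aaolfgba EBabobea Cabocea Dabodea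
     Fabeofl GIabgoil Hbdecdabkhloif aaoeaihk aaolfgba MFablofm NIabloin Jabmojn CBabobca Dabocda GHbycbdaefgloikh
     cfabdecoglifknmhj aaocaigf HBDabobda bdbcdaefhloik GDbddbcaefghoij cgabcdefghijklmno aaohfgba aaolfhca
     aaolknea aaolkmae -";
    "a ab abc abcd e bf cf agh dgh bgh dfik afjk fijk | H ng | NG-FEabeofn Habhofn Iabfoni Jabfonj Kabfonk Lablofn
     Mabmofn Baaebonih aaonigbe CABDEacoabcde aboabe aboabd aboacb aaaconfg BAaboabc Dabobda Eabobea Kabobkg
     Iaaoigfec HJabhojn Lbdbcdaefhloik aaobailf aaobaihf aaonfgbc -";
    "a ab abc abcd e bf cf agh dgh bgh dfik afjk | D l | LADabandl Babnabd Cabnacb Eabnaeb Iabanil GKabngkb Fabgnfl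
     Hbdacdbefhlnki aanabkhf aanligbc GFabgnfl Iabgnil Kabgnkl Babnbgk MJabgnjm CDabncda Eabncea Hbycbdaefglnikh
     chabecdlkfmhgnij HEDabndea bdebcadjghnif Dbddbcaefghnij ciabedchkfmlgjin aangfhca aanlfmab KBabnbkg Dabdnlk
     Fabfnlk aanlfgba Caaacnlkg HFabhnfl Iabhnil Daandaigf Eaaneaigk Bbdbcdaefhlnik aanhfgba aanlkhca -";
    "a ab abc abcd e bf cf agh dgh bgh dfik fijk | H mg | MG-KBabnbkg Fabfnmk Habhnkm Iabinmk Jabjnmk Lablnkm
     Aaanabgfh aanmfgba CABDEacnabcde abnabe abnabd abnacb aaacnmkg Aaacanmkg HFabhnfm Iabhnim Jabhnjm Daandaigf
     Eaaneaigj BLbdbcdaefhlnik aanbailf aanhfgba aanmkhca -";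
    "a ab abc abcd e bf cf agh dgh bgh dfik | D k | KBGAabambg Cabmbca Dabmbda Eabmbea Fabbmgf Iabbmgi Jabbmgj
     Habbmkh aambaihf abmbkg Gabmgkb DAabmadb Cabmcda Eabmdea Labdmlk FHabfmhk Ibddaebchifmgl aamdbgih aamkgfea
     ACabmacb Eabmaeb FHabfmhk Labfmlk JIbyabecdlkfmhgi cjabedchkfmlgji aamabgjh aamkgfec IHabimhk Labimlk
     JECabmcea Fbyebacdlkimhgf cjebadchkimlgjf FCbdcaebdlifmgh ckabcdefghijklm aamigfed aamihjdb aamkgiad -";
    "a ab abc abcd e bf cf agh dgh bgh fijk fijk bhlm | H nk | NK-MBabbonm Fabfomn Habhonm Iabiomn Jabjomn Lablonm
     Aaaoabkhf Caaocailf aaomfhca DBabdobn Aaboadb aaadonmk Aaadaonmk IHabiohn Labioln BCabobca Eabobea Gabobgk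
     FJcdabcdefghijko aaobchjl aaobchfl aaoihkbd aaonmiad -";
    "a ab abc abcd e bf cf agh dgh bgh fijk fijk | H lg | LG-EFabenfl CABDacnabcde abnabd abnacb abncea Aabnaec
     Babnbea aanlfgba KBabnbkg Fabfnlk Habhnkl Iabinlk aanligbe Aaaeanlkg Caaacnlkg HFabhnfl Iabhnil Jabhnjl
     Daandaigf BMcmabcdefghijklmn aanbaimf aanhfgba aanlkhca -";
    "a ab abc abcd e bf cf agh dgh bgh fijk | D k | KABabambk Cabmacb Dabmadb Eabmaeb Gabmgkb FHabfmhk Labfmlk
     JIbybacdefmhkjig cldbcaefghjikm aamabgjh aamkgfec LBabbmkl Gabmgkb Fabfmlk aamlfgba DBabmbda Cabmcda Eabmdea
     Gabmgkb FHabfmhk IJbybdcaefmhkijg clabcdefghijkm aamdbgih aamdbgfl IGabimgk Babmbkg Habimhk JECabmcea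
     Fbybecadjmhkifg clabcedjghifkm FCcbabcdefgmijkh cnabcdefghijkml aamigfed aamihjdb aamkliad -";
    "a ab abc abcd e bf cf agh dgh bgh | D k | KBGAabalbg Cablbca Dablbda Eablbea Fabblgf Iabblgi Jabblgj Habblkh
     aalbaihf ablbkg Gablgkb ACablacb Dabladb Eablaeb FHabflhk JIbybacdeflhkjig cldbcaefghjikl aalabgjh aalkgfec
     DCablcda Eabldea FHabflhk IJbybdcaeflhkijg clabcdefghijkl aaldbgih aalkgfea IHabilhk JECablcea Fbybecadjlhkifg
     clabcedjghifkl FCcbabcdefglijkh coabcdefghijkl aaligfed aalihjdb aalkgiad -";
    "a ab abc abcd e bf cf agh dgh cg bh dfikl eijkl afjkl fijkl ghmnop ghmnop fijklr ghmnos fijklqt fijklqr | H pv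
     | PV-QFabfwpq Gabgwqp Habhwqp Iabiwpq Jabjwpq Kabkwpq Lablwpq Mabmwqp Nabnwqp Oabowqp Rabqwpr Uabpwqu
     Taawthfvk aawpkgth AIabawip BCDEacwabcde abwabe abwabd abwabc aabawpqv Baaabwpqv GFabgwfp Iabgwip Jabgwjp
     Kabgwkp Rabgwrp Caawcaivf Daawdaivf Eaaweaivj HLabhwlp Tabgwth aatgwplv aawgfhca aawpqgba -";
    "a ab abc abcd e bf cf agh dgh cg bh dfikl eijkl afjkl fijkl ghmnop ghmnop fijklr ghmnos fijklqt | H ps qt |
     PQFabfvpq Gabgvqp Habhvqp Iabivpq Jabjvpq Kabkvpq Lablvpq Mabmvqp Nabnvqp Oabovqp Rabqvpr Uabpvqu TS-aavqhfsk
     aavpkgth S-AIabavip BCDEacvabcde abvabe abvabd abvabc Cabvacb Dabvadb Eabvaeb GFabgvfp aacavgfs aavpigbc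
     BCabvbca Dabvbda Eabvbea Labbvlp HFabhvfp aaabvhfs aavplhca GFabgvfp Iabgvip Jabgvjp Kabgvkp Rabgvrp Caavcaisf
     Daavdaisf Eaaveaisj HLabhvlp Tabgvth MNOUcqceadbgfihmonjlkvuprstq aavgquls aavgfoac aavginec aavgfmda aavgfhca
     aavpqgba QT-AOabavoq BCDEacvabcde abvabe abvabd abvabc Cabvacb Dabvadb Eabvaeb FGabfvgq aacavfgt aavqofeb
     BCabvbca Dabvbda Eabvbea Gabbvgq FHabfvhq aaabvfht aavqgfea IGabivgq Habivhq Mabivmq Nabivnq Uabivuq Caavcbgtm
     Daavdbgth Eaavebgth FOabfvoq Sabfvsi JKLRcqabcdefghijklmnovqrstup aavfprnt aavfhlba aavfgkca aavfgjda aavigfec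
     aavqpiab -";
    "a ab abc abcd e bf cf agh dgh cg bh dfikl eijkl afjkl fijkl ghmnop ghmnop fijklr ghmnos | H qr | QR-BGabbugq
     DACEacuabcde abuabe abuabc abubda Aabuabd Cabubca Eabubea FHabfuhq aaabufhr aauqgfea CAabuacb Dabucda Eabucea
     Habcuhq FGabfugq aaacufgr aauqhfea PFabfupq Gabguqp aaupfgbc KGabkugq Mabkumq Nabkunq Oabkuoq Aaauabgrm
     Daaudbgrn Eaauebgrm Haauhrgba FSabfusk IJLTcrabcdefghijklmnoutqprs aaufprnt aaufhlba aaufgjda aaufgiac
     aaukgfea aauqpkcb -";
    "a ab abc abcd e bf cf agh dgh cg bh dfikl eijkl afjkl fijkl ghmnop ghmnop fijklr | H qr | QR-AOabatoq
     CBDEactabcde abtabe abtabd abtacb Babtabc Dabtadb Eabtaeb FGabftgq aacatfgr aatqofeb PFabftpq Gabgtqp Habhtqp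
     Iabitpq Jabjtpq Kabktpq Labltpq Mabmtqp Nabntqp Oabotqp Baatbaihf aatpfgba Baaabtqpr IGabitgq Habithq Mabitmq
     Nabitnq Caatcbgrm Daatdbgrh Eaatebgrh FOabftoq Sabftsi JKLcsceadbgfihmonjlkqtprs aatfhlba aatfgkca aatfgjda
     aatigfec aatqpiab -";
    "a ab abc abcd e bf cf agh dgh cg bh dfikl eijkl afjkl fijkl ghmnop ghmnop | H rq | RQ-PFabfspr Gabgsrp Habhsrp
     Iabispr Jabjspr Kabkspr Lablspr Mabmsrp Nabnsrp Oabosrp ABCDcpasbcdjpgikr absabd absabc aasabgfh Baasbaihf
     aaspfgba AOabasor BCDEacsabcde absabe absabd absabc aabasrpq Baaabsrpq IGabisgr Habishr Mabismr Nabisnr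
     Caascbgqm Daasdbgqh Eaasebgqh FOabfsor JKLctceadbgfihmonjlkrspq aasfhlba aasfgkca aasfgjda aasigfec aasrpiab -";
    "a ab abc abcd e bf cf agh dgh cg bh dfikl eijkl afjkl fijkl ghmnop fijkl ghmnor | H pr qs | EBACDactabcde
     abtabd abtabc abtbea Aabtaeb Cabtcea Dabtdea KNabetnk IGabitgk Mabitmk bdeacbdmiktgn aatkniab RQaaqtrkca
     -Gaaaetgkr aatebgkr ABabtabe Cabtacb Dabtadb GIabatig HFabgtfh Jabgtjh bdabcdefghtji aatgihcd KOabatok
     FMabftmk bdacebdmkftgo aatkgfed Faatfgkcd aatackgf PSR-FGabgtfp Habhtfp Iabftpi aatsgiae aatsrfea NIabntip
     Jabntjp Kabntkp Labntlp Qabntqp R-Baatbairj Caatcairj Daatdairk Faatfriab GHMOcuabcdefghijklmnoptq aatgfoac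
     aatgfmda aatgfhca aatnigbc Gaatgsnea Caatcensg Daatdensg Haathsnea Baatbchsn Maatmsgba Oaatosgbc FIabftpi
     aatfgiac aatpfgba QS-FGabftgq Habfthq Mabftmq Oabftoq Baatbaosh Caatcbgsm Daatdbgsh INabitnq Rabftri
     JKLcuaebcdmflohgnkjiqtp aatfhlba aatfgkca aatfgjda aatfgiac aatqpfea -";
    "a ab abc abcd e bf cf agh dgh cg bh dfikl eijkl afjkl fijkl ghmnop fijkl | H rp | RP-FEabesfr Gabgsfr Habhsfr
     Iabfsri Jabfsrj Kabfsrk Labfsrl Mabmsfr Oabosfr NBaaebsrih aasrigbe aasfhink AIabasir BCDEacsabcde absabe
     absabd absabc aabasrfp Baaabsrfp GIabgsir Jabgsjr Kabgskr Caascaipf Daasdaipf Eaaseaipj HQabgsqh Labhslr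
     MNOcvceadbgfihmonjlksrqp aasgfoac aasginec aasgfmda aasgfhca aasrfgba -";
    "a ab abc abcd e bf cf agh dgh cg bh dfikl eijkl afjkl fijkl ghmnop | C abcdeacbdaaabbbba | CBADEacrabcde
     abrabe abrabd abrbca Aabracb Dabrcda Eabrcea NKabcrkn GIabgrin Jabgrjn bdcbeadjgnrik aarnkgba QHabcrhq
     FGabfrgq Mabfrmq Oabfroq Pabfrpq Ibdcaebdmifrgh aarcbgim aarqhfea Gaargqnea aarcbgqn PLBabbrlp Fabfrpl Habhrlp
     aarpfhcb DAabradc Babrbda Eabrdea Jabdrjp GFabgrfp Iabgrip Kabgrkp Qabgrqp Hbddbcaefghrij aardaihf aarpjgba
     HFabhrfp Iabhrip Jabhrjp Qabhrqp MKabmrkp BAabrabc Eabrbea bdbcdaefhmril GAEabraeb bdabcdefghrji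
     OEbdebcadjghrif Ncuabcdefghijklmnoprq aarginec aargfoac aarhfgbd aarpfmdc aarplhcd ABabrabc Dabradb Eabraeb
     LOabarol FHabfrhl Mabfrml bdabecdmlfrho aarlofec Faarfplbc aarablpf IBDabrbda Eabrbea Gabbrgi FHabfrhi Mabfrmi
     bdbaecdmifrhg aarigfec KGabirgk Mabirmk Nabirnk LHabirhl Oabkrol EDabrdea bdeacbdmikrgn FDbddaebchifrgm
     JQcuaebcdmflohgnkjiqrp cwabcdefghijklmnopqr aarfgjda aarigfec aarimlbc aaripkcb Faarfpiac Baarbaipf Daardaipf
     Jaarjpiab Eaareaipj Kaarkpfea Laarlpfea Qaarqpfea NGHMOcwacdebgkjonmhfliqpr aargfoac aargfmda aargfhca
     aarnigbc Gaarginec Haarhfgba Maarmfgba Oaarofgbc -";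
    "a ab abc abcd e bf cf agh dgh cg bh dfikl eijkl afjkl fijkl fijkl | H pq | PQ-IAabarip Fabfrpi Gabgrip Habhrip
     Jabirpj Kabirpk Labirpl Mabmrip Nabnrip OBaaabrpfh aarpfgba aarihfok EFaberfp BACDacrabcde abrabd abrabc
     abrbea aaberpiq Baaebrpiq GFabgrfp Jabgrjp Kabgrkp Aaaraefqj Caarcaiqf Daardaiqf HLabhrlp
     MNOcxabcdenlkomhgjfirp aargfoac aarginec aargfmda aargfhca aarpigbe -";
    "a ab abc abcd e bf cf agh dgh cg bh dfikl eijkl afjkl fijkl ghmno | C abcdeacbdaaabbbba | DCABEacrabcde abrabe
     abracb abrcda Aabradc Babrbda Eabrdea IMabdrmi FGabfrgi Habfrhi bddaebchifrgm aarimfeb NJabdrjn GKabgrkn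
     bddbeackgnrij aarnigbc Gaarginec aardbgin EAabraed Babrbea Cabrcea GFaberfg HIabgrih Jabgrjh bdebcadjghrif
     aargfhca INaberni JHabirhj bdeadbchijrgn aarigjdc Haarhigbd aarebgih FJGabfrgj Habfrhj Oabfroj Pabfrpj
     CAabracd Babrbca bdcdeabgjfroh KMabfrmk Nabjrnk BAabrabc bdbdeachjfrog LAbdadebchjfrgo Icyabcdefghijklmnorp
     aarfgiac aarfhlbd aarfgkcd Iaairfedj Kaakrfedj Laalrfedj Qaaqrfedj BAabrabd Cabrbca Gabbrgf aarfgiac HCabcrhf
     Gabgrfh aarfgjdc aarfhjdb OIaairofed NJabnrjo Kabnrko Labnrlo Qabnrqo MCAabracd Babrbca bdcdeablmnrik
     HBAabrabc bdbcdaefhmril GAbdabcdefghrji cyacdebgkjonmhflirq aarhfgbd aarmihce aarnjdmf aarofeni Kaarkofed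
     Baarbefok Jaarjofeb Caarcdjof Laarlofec Qaarqofeb AGIabarig Hbdabcdefghrji aaradjhf aaradjgf Gaargfoac
     Haarhfgba Iaarigfec Maarmfgba Naarnigbc Paarpfgba -";
    "a ab abc abcd e bf cf agh dgh cg bh dfikl eijkl afjkl fijkl | C abcdeacbdaaabbbb | ABCDEacqabcde abqabe abqabd
     abqabc Cabqacb Dabqadb Eabqaeb FOabaqof JGabfqgj Habfqhj bdadebchjfqgo aaqfojdb GIabaqig HJabgqjh
     bdabcdefghqji aaqgfhcd Haaqhfgbd aaqabgfh BCabqbca Dabqbda Eabqbea FGabbqgf IHabfqhi Mabfqmi bdbaecdmifqhg
     aaqfgiac HLabbqlh MIabhqim bdbcdaefhmqil aaqhfmda Iaaqihfed aaqbaihf ILHabiqhl Mabiqml Nabiqnl Pabiqpl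
     CDabqcda Eabqcea bdcabdenilqmh KGabiqgk Oabkqol DEabqdea bddacbenikqgm JEbdeadbchijqgn Fcyabcdefghijklmnoqp
     aaqigfec aaqigjdc aaqimkcb Faafqiabl Jaajqiabl Kaakqiabl OECabqcea aaiqokcb aaiqofeb Caaqcblof Daaqdckof
     Eaaqeckoj Gaaqgfoac aaqigfec CDabqcda Eabqcea GKabcqkg MFabgqfm bdcbdaefgmqik aaqgimde Faaqfgiad aaqcaigf
     GLaalqgiac OFabgqfo Jabgqjo Kabgqko HDEabqdea bddbcaefghqij MEbdebcadjghqif NPcxabcdenlkomhgjfiqp
     czabcdenlkomhgjfiqp aaqginec aaqgfmda aaqgfhca aaqgiaol Faaqfgiac Daaqdaigf Haaqhfgba Eaaqebgih Jaaqjgfea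
     Kaaqkgfea Laaqlhfea Maaqmfgba Naaqnigbc Oaaqofgbc Paaqpfgba -";
    "a ab abc abcd e bf cf agh dgh cg bh dfikl eijkl afjkl | C abcdeacbdaaabbb | ADBCEacpabcde abpabe abpabc abpadb
     Babpabd Cabpacb Eabpaeb NIabapin GJabgpjn Kabgpkn bdabecdjgnpki aapnigbc JOabapoj KGabjpgk bdacdbenkjpgo
     aapjnkcb Gaapgjnec aapabgjn BCabpbca Dabpbda Eabpbea FGabbpgf IHabfphi Mabfpmi bdbaecdmifphg aapfgiac HLabbplh
     MIabhpim bdbcdaefhmpil aaphfmda Iaapihfed aapbaihf CDabpcda Eabpcea FHabcphf IGabfpgi Mabfpmi bdcaebdmifpgh
     aapfhiab GKabcpkg MIabgpim bdcbdaefgmpik aapgfmda Iaapigfed aapcaigf KIGabipgk Mabipmk Nabipnk LHabiphl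
     Oabkpol DEabpdea bddacbenikpgm JEbdeadbchijpgn Fdaabcdefghijklmnop aapigfec aapigjdc aapimlbc MDabdpmk Fabfpmk
     Gabgpkm aapkgiad aapkmiab GLaalpgkca HFabgpfh Iabgpih Jabgpjh ODEabpdea bddbcaefghpij MEbdebcadjghpif
     Ndaabcdenlkomhgjfip aapginec aapgfmda aapgfoac aapgkchl Faapfgkca Daapdckgf Haaphfgba Iaapigkcd Eaapebgih
     Jaapjgfea Laaplhfea Maapmfgba Naapnigbc Oaapofgbc -";
    "a ab abc abcd e bf cf agh dgh cg bh dfikl eijkl fijkl fijkl ghmnp | H qi | QI-ENabernq DABCacrabcde abrabc
     abradb abrdea Aabraed aarqniad BAabrabe Cabrbca Dabrbda Gabbrgq aarqgiac PFabfrpq Gabgrqp aarpigbe FGabfrgq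
     Habfrhq Mabfrmq Caarcbgim Daardbgih AJOabfroj Nabjrnq KLdbbcdearkjgnmhfil aarachlm aarabgkm aarabgjh aarfgiac
     aarqpfeb -";
    "a ab abc abcd e bf cf agh dgh cg bh dfikl eijkl fijkl fijkl | H po | PO-BLabbqlp ACDEacqabcde abqabe abqabd
     abqabc Cabqbca Dabqbda Eabqbea HFabhqfp aaabqhfo aaqplhca IAabaqip Fabfqpi Gabgqip aaqpfgba Caabcqpio GFabgqfp
     Jabgqjp Kabgqkp Aaaqackof Daaqdaiof Eaaqeaioj HLabhqlp MNdcabcdefghijklmnopq aaqginec aaqgfmda aaqgfhca
     aaqpigbc -";
    "a ab abc abcd e bf cf agh dgh cg bh dfikl eijkl fijkl ghmno | H pi | PI-ENabeqnp ABCDacqabcde abqabd abqabc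
     abqaeb Babqbea aaqpniab ABabqabe Cabqacb Dabqadb FGabfqgp Habfqhp Mabfqmp Oabfqop JNabjqnp KLdbbcdeaqkjgnmhfil
     aaqachlm aaqabgkm aaqabgjh GHabgqph aaqgfhcd aaqpgfec GBabbqgp Fabfqgp Habgqph aaqphfea aaqpgiae -";
    "a ab abc abcd e bf cf agh dgh cg bh dfikl eijkl fijkl ghmn | H pi | PI-BGabbqgp CADEacqabcde abqabe abqabd
     abqbca Aabqabc aaqpgiac ACabqacb Dabqadb Eabqaeb FGabfqgp Habfqhp Mabfqmp JOabfqoj Nabjqnp KLdbbcdeaqkjgnmhfil
     aaqachlm aaqabgkm aaqabgjh GHabgqph aaqgfhcd aaqpgfec HCabcqhp Fabfqhp Gabgqph aaqhfgba aaqphiab -";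
    "a ab abc abcd e bf cf agh dgh cg bh dfikl eijkl fijkl | C abcdeacbdaaabbb | BEACDacpabcde abpabd abpabc abpbea
     Aabpabe Cabpbca Dabpbda IGabbpgi FHabfphi Mabfpmi bdbaecdmifphg aapigfec MLabbplm HFabhpfm bdbcdaefhmpil
     aapmihce Faapfmiac aapbaimf DAabpadb Cabpcda Eabpdea IMabdpmi FGabfpgi Habfphi bddaebchifpgm aapimfeb GJabdpjg
     HFabgpfh bddbcaefghpij aapgihce Faapfgiac aapdaigf CAabpacb Eabpcea IHabcphi FGabfpgi Mabfpmi bdcaebdmifpgh
     aapihfeb NKabcpkn GJabgpjn bdcbeadjgnpik aapnigbd Gaapgined aapcbgin MHFabhpfm Iabhpim Labhplm GJabgpjh
     Kabgpkm EAabpaeb bdebcadjghpif NAbdabcdefghpji Odeabcdefghijklmnop dfabcdefghijklmnop aapginec aaphfgbd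
     FEabepfm Gabgpfm Iabfpmi aapmigbc aapmfhcb OFEabepfo Gabgpfo Habhpfo Iabfpoi aapoigbc aapofmdb LJHabjphl
     Nabjpnl KGabjpgk AEabpaeb FIcpbaecdmifghp dbbcdeapkjgnmhfil aapabgfh IEbdeadbchijpgn Fddabcdefghijklmnpo
     aapigfec aapjgiac aapjhckm aaplojdc Aaapadmlo Eaapedmlo Faapfmlba Gaapgfmda Haaphfgba Iaapigfec Jaapjgfea
     Kaapkgfea Naapnigbc -";
    "a ab abc abcd e bf cf agh dgh cg bh dfikl eijkl | D f | FDEabdoef Aaboade Babobda Cabocda Mabdomf IGabfogi
     Habfohi bddaebchifogm aaofmiab BAaboabd Cabobca Eabobea Gabbogf IHabfohi Mabfomi bdbaecdmifohg aaofgiac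
     HCabcohf Eabeofh Gabgofh Iabfohi aaohigbd JGabfogj LMabfoml Nabjonl ACaboacb Eaboaeb KIcpbaecdmifgho
     dbbcdeaokjgnmhfil aaoabgkm ICEabocea bdcaebdmifogh KEcpbeacdmfigho dgabcdefghijklmno aaofgkca aaofgiad
     aaofhlbd aaofhjdb -";
    "a ab abc abcd e bf cf agh dgh cg bh dfikl fijkl fijkl ghmn | H pf | PF-ABCDEacqabcde abqabe abqabd abqabc
     Cabqacb Dabqadb Eabqaeb GIabaqig Habgqph aaqgfhcd aaqpgfec EBabqbea Cabqcea Dabqdea IGabiqgp Habiqhp Mabiqmp
     Nabiqnp JOabiqoj KLdhaebcdjqgiklfhm aaqechlm aaqebgkm aaqebgjh GHabgqph aaqgfhca aaqpgiac GBabbqgp Habgqph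
     aaqphfea aaqpgfea -";
    "a ab abc abcd e bf cf agh dgh cg bh dfikl fijkl fijkl | H no | NO-BLabbpln ACDEacpabcde abpabe abpabd abpabc
     Cabpbca Dabpbda Eabpbea HFabhpfn aaabphfo aapnlhca FEabepfn Gabgpfn Habhpfn Iabfpni aapnigbe Aaabapnfo
     GIabgpin Jabgpjn Kabgpkn Caapcaiof Daapdaiof Eaapeaioj HLabhpln Mdiabcdefghijklmnop aapgfmda aapgfhca aapnfgba
     -";
    "a ab abc abcd e bf cf agh dgh cg bh dfikl fijkl | D l | LCBabcobl Aaboacb Dabocda Eabocea Habcohl FMabfoml
     Nabfonl IGabfogi bdcaebdmifogh aaocdmin aaolhfea EAaboaec Babobea Dabodea Hbaabcdeolh IMabioml Nabionl
     JGabiogj KFcpbeacdmfigho dhaebcdjogiklfhm aaoebgkm aaoechjn aaolhiad FHabfohl Mabfoml Nabfonl KGabfogk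
     ABaboabc Daboadb JIcpbaecdmifgho dheabcdjogfklihm aaoabgjh IDBabobda bddaebchifogm JBbdbaecdmifohg
     djabcdefghijklmon aaofgjda aaofgiac aaolmkce MBabbolm Dabdoml Habholm aaolhfed aaolmfec -";
    "a ab abc abcd e bf cf agh dgh cg bh dfikl | D i | IBAabbnai Cabnbca Dabnbda Eabnbea Gabbngi FHabfnhi Mabfnmi
     bdbaecdmifnhg aanigfec HAabanih Cabcnhi Fabfnhi Gabgnih aanhfgba EAabnaeb Cabncea Dabndea JGabingj KMabinmk
     LFcpbeacdmfighn dhaebcdjngiklfhm aanechlm aanigkcd aanihjdb FGabfngi Mabfnmi LCAabnacb Dabncda bdcaebdmifngh
     KDAabnadb bddaebchifngm JAcpbaecdmifghn dkabcdefghijklmn aanfgjdc aanfmkcb aanihlbe aanihfeb -";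
    "a ab abc abcd e bf cf agh dgh cg bh fijkl cfijl | H hn | HN-JCabcohj Dabdojh Fabfohj Gabgojh Iabiohj Labjohl
     Mabhojm Aaaoacnfg aaojgiac ECabeoch Aaboaec aaaeohjn Aaaeaohjn Baaabohjn GFabgofh Iabgoih Daaodainf
     Ccpacbdefhgijo aaogfnca aaohjgba -";
    "a ab abc abcd e bf cf agh dgh cg bh fijkl fijkl fijkl ghno | H pf | PF-ADBCEacqabcde abqabe abqabc abqadb
     Babqabd Cabqacb Eabqaeb GIabaqig Habgqph aaqgfhcd aaqpgfec EBabqbea Cabqcea Dabqdea KGabkqgp Nabkqnp Oabkqop
     IMabiqmk Habiqhp JLdlaebcdjqgiklfh aaqechlm aaqebgjh aaqebgin GHabgqph aaqgfhca aaqpgkca GBabbqgp Habgqph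
     aaqphfea aaqpgfea -";
    "a ab abc abcd e bf cf agh dgh cg bh fijkl fijkl fijkl gho | H pf | PF-GBabbqgp Habgqph Iabiqgp Jabjqgp Kabkqgp
     Oabgqpo LEaabeqphi aaqphfeb aaqgkolh ACBDEacqabcde abqabe abqabd abqacb aacaqpgf EBabqbea Cabqcea Dabqdea
     Haaqhfgba IOabiqop JMabiqmj Nabiqnj KLdlaebcdjqgiklfh aaqechlm aaqebgkm aaqebgjh aaqebgih aaqpgfea -";
    "a ab abc abcd e bf cf agh dgh cg bh fijkl fijkl fijkl | H om | OM-BLabbplo ACDEacpabcde abpabe abpabd abpabc
     Cabpbca Dabpbda Eabpbea HFabhpfo aaabphfm aapolhca FEabepfo Gabgpfo Habhpfo Iabfpoi aapoigbe Aaabapofm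
     GIabgpio Jabgpjo Kabgpko Caapcaimf Daapdaimf Eaapeaimj HLabhplo Ndnabcdefghijklmnop doabcdefghijklmnop
     aapgfhca aapofgba -";
    "a ab abc abcd e bf cf agh dgh cg bh fijkl fijkl | D l | LCBabcobl Aaboacb Dabocda Eabocea Habcohl FMabfoml
     Nabfonl IGabfogi JKcpacbdefogijk dmabcdefgoijklmh aaocbgjm aaofhiab aaolhfea MBabbolm Fabfoml Habholm aaomfhcb
     ABaboabc Daboadb Eaboaeb FHabfohl Nabfonl JGabfogj KIcpcabdefogkji dldabcefogjklih aaoabgkm aaoachjm aaolmfec
     IHabiohl Nabionl KGabiogk DBabobda Eabodea FJcpadbcefogikj dladbcefogikljh aaodbgfh JEBabobea Fcpaebcdjogikf
     dlaebcdjogiklfh FBcpabcdefohijl dpabcdefghijklomn aaoigfec aaoigjdc aaolmkca aaolmiac -";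
    "a ab abc abcd e bf cf agh dgh cg bh fijkl | D j | JBDabbndj Aabnabd Cabnbca Eabnbea Gabbngj FHabfnhj Mabfnmj
     IKLcpabcdefnhijl dmacbdefhnijlkmg aanfgkca aanbchim aanjgfea HCabcnhj Dabdnjh Fabfnhj Gabgnjh aanhfgbd
     ACabnacb Dabnadb Eabnaeb FGabfngj Mabfnmj KLIcpcabdefngkji dldabcefngjklih aanachlm aanabgkm aanjhfeb IGabingj
     Mabinmj LECabncea Dabndea KFcpaebcdjngikf dlaebcdjngiklfh aanebgkm FCDabncda Kcpacbdefngijk dmabcdefgnijklmh
     KDcpadbcefngikj dqabcdefghijklnm aanfgkca aanihfeb aanjhlba aanjhiab -";
    "a ab abc abcd e bf cf agh dgh cg bh | H kb | KB-ACabmacb Dabmadb Eabmaeb Gbadbceamgk FJHabfmhj LIcpcabdefmgkji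
     dldabcefmgjklih aamfhlbd aamfgjdc aamkgfed HCabhmck GFabgmfh Iabgmih aakmhiab aahmkgba IGabimgk LDCabmcda
     Eabmdea FJcpadbcefmgikj dladbcefmgikljh aamdbgfh JECabmcea Fcpaebcdjmgikf dlaebcdjmgiklfh FCcpacbdefmgijk
     drabcdefghijklm aamigfed aamihjdb aamkgblh Faamfhiab Daamdaihf Jaamjhiab Eaameaihj GCabcmkg aamgfhca aamkgfea
     -";
    "a ab abc abcd e bf cf agh dgh cg gh afjkl dfikl | H lf | LF-AMabaoml CBDEacoabcde aboabe aboabd aboacb Baboabc
     Daboadb Eaboaeb aaolmfeb GBabbogl Habgolh Iabiogl aaolhiab EBabobea Cabocea Dabodea Haaohfgba INabionl
     JMabjoml dsbaecdnifghom aaoebgjh aaoebgih aaolgfea -";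
    "a ab abc abcd e bf cf agh dgh cg gh afjkl | H lj | LJ-GBabbngl Fabfngl Habgnlh Iabingl Kabkngl Mabgnlm
     Eaabenlhi aanlhfeb EABCDacnabcde abnabd abnabc abnaeb aaaenlgj DAabnade Babnbda Cabncda Haanhjgba FMabfnml
     IKdtabdcefgnikjlmh aandamkg aandbgih aandbgfh aanlgjde -";
    "a ab abc abcd e bf cf agh dgh cg gh | H li | LI-GBabbmgl Fabfmgl Habgmlh Jabjmgl Kabkmgl Eaabemlhi aamlhfeb
     DCABEacmabcde abmabe abmacb abmcda aacdmlgi ABabmabd Cabmacb Eabmaeb Haamhigbd FJKducbadefgmkjilh aamfgkcd
     aamabgjh aamabgfh aamlgiad -";
    "a ab abc abcd e bf cf agh dgh cg | D h | HACabalch Bablabc Dabladb Eablaeb Iabalih GFabglfh Jabgljh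
     bdabcdefghlji aalhigbd EBablbea Cablcea Dabldea Fabelfh GIabglih Jabgljh bdebcadjghlif aalhfgba GFabglfh
     Iabglih Jabgljh Kaaklhfea CBablbca Dablcda cpacbdefhgijl DBablbda bddbcaefghlij Bcpabcdefghijl dvabcdefghijkl
     ICabclhi Fabflhi aaligfec BCablbca Dablbda Faalfgiac Jaaljgfea Kaalkgfea dsacbdefhgijlk aalhigbe -";
    "a ab abc abcd e bf cf agh dgh gh dfik | H ki | KI-GBabbmgk Fabfmgk Habgmkh Jabjmgk Labgmkl Eaabemkhi aamkhfeb
     ECABDacmabcde abmabd abmacb abmcea aacemkgi ABabmabe Cabmacb Dabmadb Haamhigbd FLabfmlk dwbeacdlfighm aamabgfh
     aamkgiae -";
    "a ab abc abcd e bf cf agh dgh gh | H kj | KJ-GBabblgk Fabflgk Habglkh Iabilgk Eaabelkhi aalkhfeb ACBDEaclabcde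
     ablabe ablabd ablacb aacalkgj DBablbda Cablcda Eabldea Haalhjgba FIdxabcdefghijkl aaldbgih aaldbgfh aalkgjda -";
    "a ab abc abcd e bf cf agh dgh | D g | GDBabdkbg Aabkadb Cabkcda Eabkdea Jabdkjg HFabgkfh Iabgkih bddbcaefghkij
     aakgjhca EAabkaed Babkbea Cabkcea Fabekfg HIabgkih Jabgkjh bdebcadjghkif aakgfhca HFabgkfh Iabgkih Jabgkjh
     BAabkabd Cabkbca cpabcdefghijk CAabkacb cpacbdefhgijk Abdabcdefghkji dyabcdefghijk JBabbkgj Fabfkgj aakjhfeb
     CAabkacd Babkbca Faakfhjda Iaakihfeb dwabcdefghijk aakgjhce -";
    "a ab abc abcd e bf cf agh | D d | DCABEacjabcde abjabe abjacb abjcda Aabjadc Babjbda Eabjdea HFbaacebdjhf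
     GIabgjih dzabcedjghif aajhfgba IFGabfjgi dzbaecdjifgh aajihfeb Faajfhiab aajdaihf -";
    "a ab abc abcd e bf cf af df ghij ek eghijl ghijl fmn | H oi | OI-NFabfpon Gabgpno Habhpno Jabjpno Lablpno
     Mabmpon KABCDEacpabcde abpabe abpabd abpabc aapabgfh Baapbaifh aapofgba aapofgkl BCADEacpabcde abpabe abpabd
     abpbca aacbponi ACabpacb Dabpadb Eabpaeb GFabgpfo Mabgpmo Heaebcdapghf aapaefhn aapongbc aaponiab -";
    "a ab abc abcd e bf cf af df ghij ek eghijl ghijl | H kn | KN-ELabeolk Maboeml ABCDacoabcde aboabd aboabc
     aboaeb Babobea Cabocea Dabodea GFabeofg Habgokh aaogfhca aaaeokgn GBabbogk Fabfogk Habgokh aaokhfeb Aaaeaokgn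
     FHabfohk Iabfoik Jabfojk Baaobainh Caaocaing Daaodbgnh MLabolme ebabcdefghijnlmko aaokgmea aaokgfea -";
    "a ab abc abcd e bf cf af df ghij ek eghijl | D l | LMEAabanel Babnbea Cabncea Dabndea Fabfnel Kabenlk Gabenmg
     aanlkgba abnlme Eabnelm ABabnabe Cabnacb Dabnadb GKabgnkl Heaebcdanghm aanaemhk aanlmgbc BCabnbca Dabnbda
     HKabhnkl Ieaeacdbnihm aanbemik aanlmhca GKabgnkl IFabgnfi CDabncda eaeabdcnigf HDeaebcadnghf Jecabcdefghijnlmk
     aangfjda aangfhca aangkiae aanlmgba -";
    "a ab abc abcd e bf cf af df ghij ek ghijl ghijl fmn | H oi | OI-MFabfpom Gabgpmo Habhpmo Jabjpmo Lablpmo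
     Nabmpon KABCDedabcdpkghijfom abpabd abpabc aapabgfh Baapbaifh aapofgba aapofgkl BCADEacpabcde abpabe abpabd
     abpbca aacbpomi ACabpacb Dabpadb Eabpaeb GFabgpfo Nabgpno Heaebcdapghf aapaefhm aapomgbc aapomiab -";
    "a ab abc abcd e bf cf af df ghij ek ghijl ghijl fm | H oh | OH-MFabfpom Gabgpmo Iabipmo Jabjpmo Lablpmo
     KNABCDedabcdpkghijfom abpabd abpabc aapabgfh Baapbaifh aapofgba aapofgnl aapofgkl ABCDEacpabcde abpabe abpabd
     abpabc aabapomh CBabpbca Dabpcda Eabpcea GFabgpfo Ieaeabdcpigf aapcefim aapomgba aapomhca -";
    "a ab abc abcd e bf cf af df ghij ek ghijl ghijl | H mk | MK-GBabbogm Fabfogm Habgomh Iabgomi Jabgomj Labgoml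
     Nabmogn Eaabeomhk aaomhfeb AIabaoim CBDEacoabcde aboabe aboabd aboacb aacaomgk Caaacomgk Daaadomgk Eaaaeomgk
     FHabfohm Iabfoim Jabfojm Baaobaikh Laaolkgba Neeabcdefghijklmno efabcdefghijklmno aaomgfea -";
    "a ab abc abcd e bf cf af df ghij ek ghijl | D l | LKEabenlk Gabgnkl Habhnkl Iabinkl Jabjnkl Mabknlm Aaaeankgm
     Baanbaimh aanlmgba AEabanel Babnabe Cabnacb Dabnadb GMabgnml HFabgnfh eaebcdanghf aangkhcd aanlkgbc BCabnbca
     Dabnbda Eabnbea HMabhnml IFabhnfi eaeacdbnihf aanhkiad aanlkhca GMabgnml IFabgnfi CDabncda Eabncea eaeabdcnigf
     HDEabndea eaebcadnghf JEedabcdefghijkln egabcdefghijnlkm aangfjda aangfhca aanlkiab aanlkgba -";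
    "a ab abc abcd e bf cf af df ghij ek | D l | LKEabemlk Gabgmkl Habhmkl Iabimkl Jabjmkl FABabmabe Cabmacb
     aalmfgbc BCabmbca aalmfhca aalmfgba Aaalmaifg aamkgfea AEabamel Babmabe Cabmacb Dabmadb GHFabgmfh eaebcdamghf
     aamgkhcd aamlkgbc BCabmbca Dabmbda Eabmbea HIFabhmfi eaeacdbmihf aamhkiad aamlkhca GIFabgmfi CDabmcda Eabmcea
     eaeabdcmigf HDEabmdea eaebcadmghf JEedabcdefghijklm ehabcdefghijmlk aamgfjda aamgfhca aamlkiab aamlkgba -";
    "a ab abc abcd e bf cf af df ghij | H kf | KF-DJabdljk ABCEaclabcde ablabe ablabc abladb Bablbda Cablcda
     Eabldea aalkjfea EAablaed Bablbea Cablcea JGabglkj aaljfgba Gaalgfjda Haalhfgba Iaalifgbc eiabcdefghijkl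
     GBabblgk Habglkh aalkhfeb aalkgfed -";
    "a ab abc abcd e bf cf af df fh | H je | JE-DAablade Bablbda Cablcda Fabdljf GHeaebcadlghf aalgfhca aaljfgba
     HFabhlfj Kablhkf aakhljde Kaahkljde CAablacd Bablbca Fbaadebcljf aaacljfk aaljdchk -";
    "a ab abc abcd e bf cf af df | H he | HE-DAabkade Babkbda Cabkcda Fbaacebdkhf Geaebcadkghf aakhfgba ABabkabd
     Cabkacb Fbabcedakhf Geaebcdakghf aakhfgbd FCabckhf Gabgkfh Iabhkfi Jabhkfj Bbaacedbkhf ekabcdefghijk
     IJBCabkbca eaeacdbkihf GCeaeabdckigf ejabcdefghijk aakhfgba aakhfjda aakhfiad -";
    "a ab abc abcd e bf cf af | D d | DABCEacjabcde abjabe abjabc abjadb Babjbda Cabjcda Eabjdea FGbaabecdjgf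
     Hbaacebdjhf Ibabaecdjif eladbcefjgih GHeaebcadjghf aajgfhca Haajhfgba aajdbgfh -";
    "a ab abc abcd e bf cf | D a | AEBCDaciabcde abiabd abiabc abiaeb Babiabe Cabiacb Dabiadb FGbacbedaigf
     Hbabcedaihf embacdefihg GHeaebcdaighf aaigfhcd Haaihfgbd aaiabgfh -";
    "a ab abc abcd e bf c a d fghij | D i | IBAabblai Cablbca Dablbda Eablbea Fencaedblif Gaafgliac aaliaefg
     GKabglki Fablfgk EAablaeb Cablcea aafgliac aalikfeb CAablacb Dablcda Eablcea Faagfliad aaliabgf KFablfkg
     Aabalik aaliabgf aalikgbc -";
    "a ab abc abcd e bf c a d ch ai ail ailm | D i | IALMNacoailmn aboain aboaim aboail Laboila Maboima Naboina
     CBabobca Dabocda Eabocea Faaliofeb aaliocef HKabohkc Baakhobal aakhoiab Baaliobch Daaliodch Eaalioech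
     Faafoiach Gaaogfech aaoiabgf -";
    "a ab abc abcd e bf c a d ch ai ail | D l | LAIMBabbnai Cabnacb Dabnadb Eabnaeb FGbacbedangf aainfgbc Gaaingfec
     Haanhcbgf Jaanjdbgf Kaankcbgf epabcdefghnjkilm abnaim abnali Iabnila Mabnlma DBabnbda Cabncda Eabndea
     Faailnfeb aailndef EBabnbea Cabncea Gaailngbc aailnebg Faailnfed Gaangfeai aanlaefg -";
    "a ab abc abcd e bf c a d ch ai | D i | IALBabbmai Cabmacb Dabmadb Eabmaeb GFbacbedamgf aaimgfec Faaimfgbc
     Haamhcbgf Jaamjdbgf Kaamkcbgf eqabcdefghmjkil abmail Labmila CBabmbca Dabmcda Eabmcea Faalimfeb aalimcef
     FHaafmhcal aafmiach Gaafgmiac Baalimbgf aamiabgf -";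
    "a ab abc abcd e bf c a d ch | H ic | IC-ABablabc Dabladb Eablaeb FGbacbedalgf aailfgbc Gaailgfec Haalhcbgf
     Jaaljdbgf Kaalkcbgf ercbadefglhjik FGBabblgf Eabelfg HKablhkc aakhlfea aafliach aagfliac Gaafgliac BDablbda
     Eablbea aaliaefg aaliabgf -";
    "a ab abc abcd e bf c a d | H he | HE-ABabkabe Cabkacb Dabkadb Fenbcedakhf Gaafgkhcd aakhcbgf FIDBabkbda
     Cabkcda enacebdkhf JGBabbkgf Cbaabedckgf eoabcdefghijk aagfkiad aahkfedj aahkfeai Gaahkgfea CBabkbca Dabkcda
     Iaakiabgf Jaakjdbgf esabcdefgkijh aakhcefg -";
    "a ab abc abcd e bf c a | D d | DABCEacjabcde abjabe abjabc abjadb Babjbda Cabjcda Eabjdea FGbaabecdjgf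
     enadbcefjg Genadecbgjf Haajhcbgf Iaajiabgf etabdcefgjih -";
    "a ab abc abcd e bf c | D a | ABCDEaciabcde abiabe abiabd abiabc Cabiacb Dabiadb Eabiaeb FGbacbedaigf
     encabdefig Gencaedbgif Haaihcbgf eucbadefgih -";
    "a ab abc abcd e bf | D c | CBADEachabcde abhabe abhabd abhbca Aabhacb Dabhcda Eabhcea FGbaabedchgf enacbdefhg
     Genacedbghf evabcdefgh -";
    "a ab abc abcd e b c a d fghij fghij fghij lm | H nj | NJ-LFabfoln Gabgoln Habholn Iabioln Mablonm
     ABCDewaocdbgl aboabd aboabc aaoabgmf Baaobaimf aaonmgba ABCDEacoabcde aboabe aboabd aboabc aabaonlj DBabobda
     Cabocda Eabodea Fewaebcdof aaonlfea aaonljda -";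
    "a ab abc abcd e b c a d fghij fghij fghij m l mn lo fghij mnp k kt loq ktu loqv | D x | XLOQVacyloqvx abylov
     abyloq abylxo Oabyoxl Qabyqxl Vabyvxl Fewolqvxyf Gewolqvxyg Hewolqvxyh Iewolqvxyi Jewolqvxyj KAaaaykflo
     aaoxykia Taaytkflo aayxlfkt -";
    "a ab abc abcd e b c a d fghij fghij fghij m l mn lo fghij mnp k kt loq ktu | D q | QLOVFabfxlo Gabgxlo Habhxlo
     Iabixlo Jabjxlo Aewoxqvlia Bewoxqvlgb Naanxlgba Kaaoxkgba Caaxcbgkf Daaxdbgkf Eaaxebgkh Maaoxmfea Paaxpmfea
     Raaoxrfea Saaxsmfea Taaxtkfea Uaaxukfea Waaxwkfea eyabcdefghijklmnxporstuqwv abxlov abxlqo Oabxoql Vabxqvl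
     KMFabkxfm Gabkxgm Habkxhm Iabkxim Jabkxjm Aaaaxkflo aaoqxkia FEabexfk Gabfxkg aaoqxfmg aaoqxkfm FGMabfxmg
     Rabfxrg HIJNPabxnpm aapnxflo aaoqxfmn aaoqxfkj aaoqxfki aaoqxfkh aaoqxfkg Taaxtkflo aaxqlfkt -";
    "a ab abc abcd e b c a d fghij fghij fghij m l mn lo fghij mnp k kt loq | D u | UKTFabfwkt Gabgwkt Habhwkt
     Iabiwkt Jabjwkt RLAMBCDewawcdbgk abwabd abwabc Cabwacb aatwlgbc aatwaimf EBabwbea aatwlgba aatwlfea Aaatwailf
     Baawbailf aatwrgba Aaatwairf Baawbairf Caawcbgrf Daawdbgrf Eaawebgrh Naanwkfea Oaaowkfea Paapwkfea Qaaqwkfea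
     Saaswkfea Laatwlfea Maatwmfea Vaawvlfea ezabcdefghijlmkwntpruoqsv abwkut Tabwtuk MLFablwfm Gablwgm Hablwhm
     Iablwim Jablwjm Aaaawlfkt aatuwlia FEabewfm Gabfwmg aatuwflg aatuwmfl IFLabfwli Rabfwri GHJNPabwnpm aapnwfkt
     aatuwfmn aatuwflj aatuwflh aatuwflg aatuwimf Naawnmikt aawukimn -";
    "a ab abc abcd e b c a d fghij fghij fghij m l mn lo fghij mnp k kt | D q | QLOFabfvlo Gabgvlo Habhvlo Iabivlo
     Jabjvlo RKAMBCDewavcdbgk abvabd abvabc Cabvacb aaovkgbc aaovaimf EBabvbea aaovkgba aaovkfea Aaaovaikf
     Baavbaikf aaovrgba Aaaovairf Baavbairf Caavcbgrf Daavdbgrf Eaavebgrh Naanvlfea Kaaovkfea Maaovmfea Paavpmfea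
     Saavsmfea Taavtkfea Uaavukfea faabcdefghijkmlvnoprqtus abvlqo Oabvoql MKFabkvfm Gabkvgm Habkvhm Iabkvim
     Jabkvjm Aaaavkflo aaoqvkia FEabevfm Gabfvmg aaoqvfkg aaoqvmfk FGKabfvkg Rabfvrg HIJNPabvnpm aapnvflo aaoqvfmn
     aaoqvfkj aaoqvfki aaoqvfkh aaoqvfmg Naavnmflo aavqlfmn -";
    "a ab abc abcd e b c a d fghij fghij fghij m l mn lo fghij mnp k | H tj | TJ-MLFablufm Gablugm Habluhm Iabluim
     ERBACewaubcefl abuabc abubea Aabuaeb aatulgba aatuefrg ABabuabe aatulfeb aatulfea OQabuoql aatumjlq aatumjlo
     DFEabduef Aabuade Babubda Cabucda ewaebcduf aatudjmf Aaatuadjm Faaufmjda Baaubdjmf Caaucdjmf Gaaugmjda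
     Eaauebgmj Haauhmfea Iaauimfeb Naaunmfea Paaupmfea Saausmfea KOaaoukfea Qaaqukfea Laatulfea Raaturfea
     fbabcdefghijlkmnuptrsoq aautkfea -";
    "a ab abc abcd e b c a d fghij fghij fghij m l mn lo fghij mnp | H km | KM-FEabetfk Gabftkg Habftkh Iabftki
     Jabftkj Labktfl Rabktfr Aaaeatkgl Baatbailh aatflgba AIabatik BCDewbtcdaik abtabd abtabc aabatkfm Baaabtkfm
     Caaactkfm Daaadtkfm EGewabcdetg aaaetkgm Gaatgmfea Haathmfea Iaatimfeb Jaatjmfea Naatnmfea Oaaotkfea Paatpmfea
     Qaaqtkfea Saatsmfea Lexabcdefghijmklt Rexabcdefghijlkrt fcabcdefghijklmnopqrst -";
    "a ab abc abcd e b c a d fghij fghij fghij m l mn lo fghij | D n | NMPFabfsmn Gabgsmn Habhsmn Iabismn Jabjsmn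
     CKLRABDewascdbgk absabd absacb Babsbca aanskgba aanschrf aanschlf aanschkf ABabsabc Dabsadb Eabsaeb Kaanskfeb
     aasabgkf Kaanskhca Baasbchkf Daasdbgkf Eaasebgkh Laanslfea Oaasolfea Qaasqlfea Raansrfea fdabcdefghijklmsonqrp
     absmnp Pabsnpm GCBabcsbg Aabsacb aaacsgmp Aaacasgmp Haapnshca aasgmhca BKAaaaskgmp Cabsbca Dabsbda Eabsbea
     Faaabsfmp aasbefmp aapnsbgk Aaasabgmp aasnmgba -";
    "a ab abc abcd e b c a d fghij fghij fghij m l mn lo | D h | HDCabdrch Aabradc Babrbda Eabrdea ewacbedrh
     MCabcrhm Fabfrmh Gabgrmh Iabhrmi Jabhrmj Kabkrhm Lablrhm Nabhrmn Pabrmpn Aaaradjkf aarhkiad BAabrabd Cabrbca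
     Eabrbea ewacdebrh GKabgrkh Labgrlh JACabracb Eabraeb ewcbdearg IECabrcea ewabcderg FCewaebdcrf
     Nexabcdefghijkrmn Paanprfea Oexabcdefghijkrlo Qaaoqrfea feabcdefghijrlmnopqk aargkfea aargkiad aarhkjdb
     aarhmgbd -";
    "a ab abc abcd e b c a d fghij fghij fghij m l mn | H oi | OI-ABCDEacqabcde abqabe abqabd abqabc Cabqacb
     Dabqadb Eabqaeb Fewbecdaqf LGabgqlo Habhqlo Jabjqlo Kaaoqkfeb aaqabgkf aaqolfeb MBCabqbca aaoqmiac aaoqmiab
     Baaoqbaim Faaqfmiab Caaqcaimf Daaqdaimf Gaaqgmiac Eaaqeaimg Haaqhmfea Jaaqjmfea Naaqnmfea LKaaoqkfea Paaqpmfea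
     ffabcdefghijkmlqnop aaqolfea -";
    "a ab abc abcd e b c a d fghij fghij fghij m l | H nj | NJ-DCABEacpabcde abpabe abpacb abpcda Aabpadc Babpbda
     Eabpdea Fewaebcdpf MGabgpmn Habhpmn Iabipmn Kaanpkfea aapdbgkf aapnmfea MFabfpmn Gabgpmn Habhpmn Iabipmn
     LEAabpaed aanpliad aanplfed Aaapadjlf Baapbailf Caapcbglf Eaapebglh Kaanpkfea Oaapolfea fgabcdefghijklmpon
     ABabpabd aapnmjdb aapnmjda -";
    "a ab abc abcd e b c a d fghij fghij fghij m | H lk | LK-FEabeofl Gabfolg Habfolh Iabfoli Jabfolj Mablofm
     Aaaeaolgk Baaobaikh aaofkgba AIabaoil BCDewbocdail aboabd aboabc aabaolfk Baaabolfk Caaacolfk Daaadolfk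
     EGewabcdeog aaaeolgk Gaaogkfea Haaohkfea Iaaoikfeb Jaaojkfea Naanolfea Mexabcdefghijklmo fhabcdefghijkmlon -";
    "a ab abc abcd e b c a d fghij fghij fghij | H mk | MK-FEabenfm Gabfnmg Habfnmh Iabfnmi Jabfnmj Lablnfm
     Aaaeanmgk Baanbaikh aanfkgba AIabanim BCDewbncdaim abnabd abnabc aabanmfk Baaabnmfk Caaacnmfk Daaadnmfk
     EGewabcdeng aaaenmgk Gaangkfea Haanhkfea Iaanikfeb Jaanjkfea Lexabcdefghijklmn fiabcdefghijklmn -";
    "a ab abc abcd e b c a d fghij fghij | D f | FAEabamef Babmabe Cabmacb Dabmadb ewbecdamf BCabmbca Dabmbda
     Eabmbea ewaecdbmf CDabmcda Eabmcea ewaebdcmf DEabmdea ewaebcdmf GKabfmkg Labfmlg HIJEewabcdemg fjabcdefghijmkl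
     aamfkjda aamfkiab aamfkhca KEabemfk Habfmkh Iabfmki Jabfmkj Labkmfl aamflgba aamfkgba -";
    "a ab abc abcd e b c a d fghij fk | D j | JDAabamdj Babmbda Cabmcda Eabmdea Kabdmjk Fewaebcdmf aamjkfea
     CAabmacd Babmbca Eabmcea ewadbecmj EAabmaec Babmbea ewadbcemj FKabfmkj Labmflk aalfmjdc KGabgmkj Habhmkj
     Iabimkj Labmklf aamjdefl aamjkfec -";
    "a ab abc abcd e b c a d fghij | D f | FAEabalef Bablabe Cablacb Dabladb ewbecdalf BCablbca Dablbda Eablbea
     ewaecdblf CDablcda Eablcea ewaebdclf DEabldea ewaebcdlf GKabflkg HIJEewabcdelg fkabcdefghijlk aalfkjda
     aalfkiab aalfkhca KEabelfk Habflkh Iabflki Jabflkj flabcdefghijkl aalfkgba -";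
    "a ab abc abcd e b c a d ch dj bg djl bgm ef ai djln j bgmo | D o | OBGMTacubgmot abubgt abubgm abubog Gabugob
     Mabumob Tabuotb Aewgbmtoua Cewgbmtouc Haagouhca Daagoudch Eaagouech Faagoufea Iaaouiaef Jaajuobef Saausjdef
     aauobdjs -";
    "a ab abc abcd e b c a d ch dj bg djl bgm ef ai djln j | D o | OBGMAabatbg Cabtbca Dabtbda Eabtbea Fewaecdbtf
     Haagthcef Iaagtiaef Jaagtjdef Kaahktbef Laajltbef Naajntbef Paafptbch Qaaiqtbef Raajrtbef Saatsjdef
     fnabcdefthijklgnmpqrso abtbgm abtbog Gabtgob Mabtmob DAabtadb Cabtcda Eabtdea ewabcedto JLabtjld Nabtjnd
     Rabtjrd Aaaljtabg aagotjda Saatsjdbg aatobdjs -";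
    "a ab abc abcd e b c a d ch dj bg djl bgm ef ai djln | D j | JDLNRacsdjlnr absdjr absdjn absdjl Labsjld Nabsjnd
     Rabsjrd Aewldnrjsa Bewldnrjsb Gaaljsgba Caaljscbg Eaaljsebg Faafsjdbg Haajshcef Iaajsiaef Kaajskcef Maajsmbef
     Oaajsobef Paafpsjda Qaajsqaef foabcdefghijklmnopqrs -";
    "a ab abc abcd e b c a d ch dj bg djl bgm ef ai l | D m | MBGOAabasbg Cabsbca Dabsbda Eabsbea Fewaecdbsf
     Haagshcef Iaagsiaef Jaagsjdef Kaahksbef Laajlsbef Naajnsbef Paafpsbch Qaaiqsbef fpadcbefjhiskglmnpqo absbgo
     absbmg Gabsgmb Oabsmob DAabsadb Cabscda Eabsdea ewabcedsm LJabsjld Nabslnd Aaajlsabg aagmslda Raasrldbg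
     aasmbdlr -";
    "a ab abc abcd e b c a d ch dj bg djl bgm ef ai | D l | LDJNAabardj Babrbda Cabrcda Eabrdea Fewaebcdrf
     Gaajrgbef Haajrhcef Iaajriaef Kaahkrdef Maagmrdef Oaagordef Paafprdbg Qaaiqrdef fpabcdefghirkjmlopqn abrdjn
     abrdlj Jabrjld Nabrlnd BAabrabd Cabrbca Eabrbea ewadcebrl ACabracb Eabraeb ewbdcearl Gaajlrgba Caajlrcbg
     Eaajlrebg Faafrldbg Haalrhcef Iaalriaef Kaalrkcef Maalrmbef Oaalrobef Paafprlda Qaalrqaef fqabcdefghijklmnopqr
     -";
    "a ab abc abcd e b c a d ch dj bg djl bgm ef i bgmo | D g | GBMORacsbgmor absbgr absbgo absbgm Mabsgmb Oabsgob
     Rabsgrb Aewmborgsa Cewmborgsc Haamgshca Daamgsdch Eaamgsech Faafsgbch Iaagsiaef Qaasqiaef aasgbaiq -";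
    "a ab abc abcd e b c a d ch dj bg djl bgm ef i | D o | ODBabdrbo Aabradb Cabrcda Eabrdea ewabcedro BAabrabd
     Cabrbca Eabrbea GMFewaecdbrf Haagrhcef Iaagriaef Jaagrjdef Kaahkrbef Laajlrbef Naajnrbef Paafprbch Qaarqiaef
     fsabcdefrhijklgnmpqo abrbgm abrbog Gabrgob Mabrmob ACabracb Eabraeb ewcbdearo Iaagoriad Qaarqiabg aarobaiq -";
    "a ab abc abcd e b c a d ch dj bg djl bgm ef | H id | ID-BAabqabd Cabqbca Eabqbea ewcadebqi OGabqgob Mabqmob
     Jaaiqjdbg aaiqobdj Jaaiqjdbo Gaaiqgbdj Laaiqldbg Maaiqmbdj Naaiqndbg CAabqacb Eabqcea ewbadecqi Haaiqhcbg
     Kaaiqkcbg EAabqaeb ewbacdeqi Faaiqfebg Paaiqpebg Afrcbedaqgfhjplmnoik ftabcdefghijklmnopq -";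
    "a ab abc abcd e b c a d ch dj bg djl bgm f | H ie | IE-BAabqabe Cabqbca Dabqbda ewcadebqi FGMabqgmb aaiqfebm
     aaiqfebg Gaaiqgbef Maaiqmbef Oaaiqobef Paaqpfebg ACabqacb Dabqadb Haaqhcefp Jaaqjdefp Kaaqkcefp Laaqldefp
     Naaqndefp fuebcdaqghfjklmnoi aaqiaefp -";
    "a ab abc abcd e b c a d ch dj bg djl bgm | H fa | FA-BCabpbca Dabpbda Eabpbea ewaecdbpf ECabpcea Dabpdea
     Gewabcdepg Haafphcbg Iaafpiabg Jaafpjdbg Kaahkpebg Laajlpebg Maagmpech Naajnpebg Oaagopech fuabcdepghijklmnof
     CDabpcda ewaebdcpf Dewaebcdpf GMabpgmb aamgpfea Haafphcbg Iaafpiabg Jaafpjdbg Kaafpkcbg Laafpldbg Maagmpfea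
     Naafpndbg Oaagopfea fvabcdefghijklmnop -";
    "a ab abc abcd e b c a d ch dj bg djl g | D k | KCHAabapch Babpbca Dabpcda Eabpcea Fewaebdcpf Gaahpgbef
     Iaahpiaef Jaahpjdef Laajlpcef Maagmpcef Naajnpcef fwacbdefpgijmlhnk abpckh Habphkc DAabpadc Babpbda Eabpdea
     ewacbedpk BAabpabc Eabpbea ewacdebpk Gaahkpgbd Oaapogbch aapkcbgo -";
    "a ab abc abcd e b c a d ch dj bg djl | D g | GBMAabaobg Cabobca Dabobda Eabobea Fewaecdbof Haagohcef Iaagoiaef
     Jaagojdef Kaahkobef Laajlobef Naajnobef fwabcdefohijklgnm abobgm Mabogmb DAaboadb Cabocda Eabodea ewabcedog
     CAaboacb Eabocea ewabdecog Haamgohcd Aaamgoach Eaamgoech Faafogbch Iaagoiaef Jaajogbef Kaakogbef Laalogbef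
     Naanogbef fxabcdefghijklmno -";
    "a ab abc abcd e b c a d ch dj bg l | D k | KCHAabaoch Babobca Dabocda Eabocea Fewaebdcof Gaahogbef Iaahoiaef
     Jaahojdef Laajlocef Maagmocef fyabdcefgjiolhmk abockh Habohkc DAaboadc Babobda Eabodea ewacbedok LJabojld
     Aaahkoadj aahkolda Naaonldch aaokcdln -";
    "a ab abc abcd e b c a d ch dj bg | D l | LDJAabandj Babnbda Cabncda Eabndea Fewaebcdnf Gaajngbef Haajnhcef
     Iaajniaef Kaahkndef Maagmndef fyabcdefghinkjml abndlj Jabnjld BAabnabd Cabnbca Eabnbea ewadcebnl CAabnacb
     Eabncea ewadbecnl Gaajlngbc Aaajlnabg Eaajlnebg Faafnldbg Haalnhcef Iaalniaef Kaalnkcef Maalnmbef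
     fzabcdefghijklmn -";
    "a ab abc abcd e b c a d ch dj g | H fa | FA-CBabnbca Dabncda Eabncea ewaebdcnf BDabnbda Eabnbea ewaecdbnf
     GHKabnhkc aafngbck aafngbch Haafnhcbg Iaafniabg Kaafnkcbg Maanmgbch EDabndea Jaanjdbgm Laanldbgm
     gaaecdbgnhijklf aanfebgm -";
    "a ab abc abcd e b c a d ch dj | H ge | GE-DAabmade Babmbda Cabmcda ewabcedmg CAabmacd Babmbca ewabdecmg
     HKabmhkc Faagmfeck aagmhcef Faagmfech Jaagmjdef Kaagmkcef Laagmldef ABabmabc ewcbdeamg Iaagmiaef
     Bgaabcdefmhijklg gbabcdefghijklm -";
    "a ab abc abcd e b c a d ch j | H id | ID-CAabmacd Babmbca Eabmcea ewbadecmi JHKabmhkc aaimjdck aaimjdch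
     Haaimhcdj Kaaimkcdj Laamljdch ABabmabc Eabmaeb Faamfedjl Gaamgbdjl gcbdacefjmghik aamiadjl -";
    "a ab abc abcd e b c a d ch | H fb | FB-CAablacb Dablcda Eablcea ewaebdclf ADabladb Eablaeb ewbecdalf DEabldea
     ewaebcdlf GHKablhkc aaflgbck aaflgbch Haaflhcbg Iaafliabg Jaafljdbg Kaaflkcbg Egcabecdjglihfk gdabcedjghifkl -";
    "a ab abc abcd e b c a d h | H ie | IE-ABablabe Cablacb Dabladb Fewbecdalf Gaailgbef Haailhcef Jaailjdef
     gebcadefhlgji BCablbca Dablbda ewcadebli DCablcda ewbacedli Cewbadecli HFGJfmabcdefghijl aaflgbdj aaflhcbg
     aahliaef Kaahkliab aaliachk -";
    "a ab abc abcd e b c a d | H hb | HB-CAabkacb Dabkcda Eabkcea Fewaebdckf Gaahkgbef Iaahkiaef Jaahkjdef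
     geabcdefgkijh ADabkadb Eabkaeb ewbcdeakh DEabkdea ewacbedkh Eewacbdekh FGIJfmabcdefghijk aafkgbdj aafkgbai
     aafkhcbg Gaahkgbef Iaahkiaef Jaajkhcef gfabcdefghijk -";
    "a ab abc abcd e b c a | D d | DABCEacjabcde abjabe abjabc abjadb Babjbda Cabjcda Eabjdea Fewaebcdjf Gewabcedjg
     Hewacbedjh Iewbacedji ggabcedjghif -";
    "a ab abc abcd e b c | D a | ABCDEaciabcde abiabe abiabd abiabc Cabiacb Dabiadb Eabiaeb Fewbecdaif Gewcbdeaig
     Hewbcdeaih ghbcedaihfg -";
    "a ab abc abcd e b | D c | CBADEachabcde abhabe abhabd abhbca Aabhacb Dabhcda Eabhcea Fewaebdchf Gewabdechg
     giabedchgf -";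
    "a ab abc abcd e | D b | BEACDacgabcde abgabd abgabc abgbea Aabgabe Cabgbca Dabgbda Fewaecdbgf gjaecdbgf -";
    "a ab abc abcd | D e | EABCDacfabcde abfabd abfabc abfaeb Babfbea Cabfcea Dabfdea gkabcdef -"
  ]%entry.

(** The parameter 4 is the k with k + 2 = 6: degrees up to 4 and colourings with 5 colours are
    reducible. *)
Lemma certificate_correct : check_entries 4 forbidden certificate.
Proof. by vm_compute. Qed.

Theorem theorem11 :
  ~ exists G : sgraph,
      [/\ vertex_critical 6 G,
          free [:: path_graph 6; diamond] G
        & clique_number G = 5].
Proof.
case=> G [crit [noP6 [noD _]] omega5].
have G_forbidden : avoids G forbidden.
  move=> P /[!inE] /or3P[] /eqP-> f.
  - by move/occurs_path6.
  - by move/occurs_diamond.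
  - by move/occurs_complete; rewrite omega5.
have G_avoids := check_entriesP crit G_forbidden certificate_correct.
(* Clique number 5 gives an occurrence of [complete_pattern 5]. This is literally the pattern of the
   last entry, so its membership among the avoided patterns is settled by computation. *)
have [|f] := @clique_number_occurs G; rewrite omega5 //.
by apply: G_avoids; rewrite mem_cat; apply/orP; right; vm_compute.
Qed.
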